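(* Let $d\ge 1$ and let $\mathcal{P}\in\mathscr{P}_d$ be a pencil of plane curves of degree $d$. If $\mathcal{P}$ contains at worst one strictly semistable curve and all other curves in $\mathcal{P}$ are stable (that is, all members of $\mathcal{P}$ are stable except possibly one, which is strictly semistable), then $\mathcal{P}$ is stable.
   Context: The ground field is $\mathbb{C}$. Let $S_d$ be the vector space of homogeneous forms of degree $d$ in three variables. A plane curve of degree $d$ is $C_f=\{f=0\}\subset\mathbb{P}^2$ with $0\ne f\in S_d$ taken up to scalar, i.e. a point of $\mathbb{P}(S_d)$ (possibly non-reduced or reducible). A pencil of plane curves of degree $d$ is a two-dimensional subspace of $S_d$; its members (the curves in it) are the $C_f$ with $f$ a nonzero element of that subspace. The space of all such pencils is $\mathscr{P}_d=Gr(2,S_d)$, embedded by Plücker coordinates in $\mathbb{P}(\Lambda^2 S_d)$. Stability: $SL(3)$ acts on $S_d$ by linear changes of coordinates, hence on $\mathbb{P}(S_d)$, on $\Lambda^2S_d$ and on $\mathscr{P}_d\subset\mathbb{P}(\Lambda^2S_d)$. A point of a projective variety $X\subset\mathbb{P}(W)$ with linear $SL(3)$-action is semistable if, for a nonzero lift $\tilde{x}\in W$, $0\notin\overline{SL(3)\cdot\tilde{x}}$; it is stable if the orbit $SL(3)\cdot\tilde{x}$ is closed in $W$ and the stabilizer of $\tilde{x}$ is finite; it is strictly semistable if it is semistable but not stable. This is applied to curves ($X=\mathbb{P}(S_d)$) and to pencils ($X=\mathscr{P}_d$). *)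

(* Defs.v *)
From HB Require Import structures.
From mathcomp Require Import all_boot all_order all_algebra.
From mathcomp Require Import boolp classical_sets cardinality reals.
From mathcomp Require Import complex mpoly.

Set Implicit Arguments.
Unset Strict Implicit.
Unset Printing Implicit Defensive.

Import GRing.Theory.
Local Open Scope classical_set_scope.
Local Open Scope ring_scope.

(** Zariski topology of a finite-dimensional vector space.  The polynomial
    functions are the polynomials in the coordinates with respect to the basis
    [vbasis fullv]; another basis gives the same functions. *)

Definition polyfun (K : fieldType) (W : vectType K)
    (p : {mpoly K[\dim {:W}]}) (w : W) : K :=
  p.@[fun i => coord (vbasis {:W}) i w].

Definition zariski_closure (K : fieldType) (W : vectType K) (A : set W) :
    set W :=
  [set w | forall p : {mpoly K[\dim {:W}]},
     (forall a, A a -> polyfun p a = 0) -> polyfun p w = 0].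

Definition zariski_closed (K : fieldType) (W : vectType K) (A : set W) : Prop :=
  zariski_closure A = A.

(** Stability.  A point of P(W) is a one-dimensional subspace [x] of [W]; its
    nonzero lifts are the nonzero vectors spanning it.  The action of SL(3) is
    the restriction to SL(3) of the map [act], whose values on other matrices
    play no role. *)

Definition SL3 (K : fieldType) : set 'M[K]_3 := [set g | \det g = 1].

Definition SL3_orbit (K : fieldType) (W : vectType K) (act : 'M[K]_3 -> W -> W)
    (w : W) : set W :=
  [set act g w | g in @SL3 K].

Definition SL3_stabilizer (K : fieldType) (W : vectType K)
    (act : 'M[K]_3 -> W -> W) (w : W) : set 'M[K]_3 :=
  [set g | @SL3 K g /\ act g w = w].

Definition nonzero_lift (K : fieldType) (W : vectType K) (x : {vspace W}) :
    set W :=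
  [set w | w != 0 /\ x = <[w]>%VS].

Definition semistable (K : fieldType) (W : vectType K)
    (act : 'M[K]_3 -> W -> W) (x : {vspace W}) : Prop :=
  exists2 w, nonzero_lift x w & ~ zariski_closure (SL3_orbit act w) 0.

Definition stable (K : fieldType) (W : vectType K)
    (act : 'M[K]_3 -> W -> W) (x : {vspace W}) : Prop :=
  exists2 w, nonzero_lift x w &
    zariski_closed (SL3_orbit act w) /\ finite_set (SL3_stabilizer act w).

Definition strictly_semistable (K : fieldType) (W : vectType K)
    (act : 'M[K]_3 -> W -> W) (x : {vspace W}) : Prop :=
  semistable act x /\ ~ stable act x.

(** Ternary forms, with (g . f)(x) = f (g^-1 x). *)

Definition ternary_form (K : fieldType) (d : nat) : vectType K := dhomog 3 K d.

Definition linear_forms (K : fieldType) (A : 'M[K]_3) : 3.-tuple {mpoly K[3]} :=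
  [tuple \sum_(j < 3) A i j *: 'X_j | i < 3].

Lemma comp_linear_forms_homog (K : fieldType) (d : nat) (A : 'M[K]_3)
    (f : {mpoly K[3]}) :
  f \is d.-homog -> f \mPo linear_forms A \is d.-homog.
Proof.
move=> /dhomogP hf; rewrite comp_mpolyE big_seq rpred_sum // => m /hf /= <-.
apply: rpredZ; rewrite mdegE.
elim: (index_enum 'I_3) => [|i s IHs]; first by rewrite !big_nil dhomog1.
rewrite !big_cons; apply: dhomogM => //.
rewrite -[X in X.-homog]mul1n; apply: dhomogMn.
rewrite tnth_mktuple; apply: rpred_sum => j _; apply: rpredZ.
by rewrite dhomogX /= mdeg1.
Qed.

Definition ternary_form_act (K : fieldType) (d : nat) (g : 'M[K]_3) (f : ternary_form K d) :
    ternary_form K d :=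
  DHomog (comp_linear_forms_homog (invmx g) (dhomog_is_dhomog f)).

(** Exterior square of [V], as the space of coordinate vectors in the basis
    e_i /\ e_j (i < j), where [e := vbasis fullv].  The coordinates of u /\ v
    are its Plücker coordinates.  For linear [phi], [ext2_map phi] is the linear
    map sending u /\ v to (phi u) /\ (phi v), written out on the basis. *)

Definition pair_index (n : nat) : finType :=
  {ij : 'I_n * 'I_n | (ij.1 < ij.2)%N}.

Definition ext2 (K : fieldType) (V : vectType K) : vectType K :=
  {ffun pair_index (\dim {:V}) -> K^o}.

Definition wedge (K : fieldType) (V : vectType K) (u v : V) : ext2 V :=
  let c i w := coord (vbasis {:V}) i w in
  [ffun ij : pair_index (\dim {:V}) =>
     c (val ij).1 u * c (val ij).2 v - c (val ij).2 u * c (val ij).1 v].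

Definition ext2_map (K : fieldType) (V : vectType K) (phi : V -> V)
    (w : ext2 V) : ext2 V :=
  let e := vbasis {:V} in
  \sum_(ij : pair_index (\dim {:V}))
     w ij *: wedge (phi e`_(val ij).1) (phi e`_(val ij).2).

Definition ext2_act (K : fieldType) (V : vectType K)
    (act : 'M[K]_3 -> V -> V) (g : 'M[K]_3) : ext2 V -> ext2 V :=
  ext2_map (act g).

(** For two-dimensional [P] the line does not depend on the basis of [P]. *)
Definition plucker (K : fieldType) (V : vectType K) (P : {vspace V}) :
    {vspace ext2 V} :=
  <[wedge (vbasis P)`_0 (vbasis P)`_1]>%VS.

(** With S_d := [ternary_form K d], curves are points of P(S_d), hence one-dimensional subspaces of S_d;
    pencils are two-dimensional subspaces. *)

Definition pencil (K : fieldType) (d : nat) (P : {vspace ternary_form K d}) : Prop :=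
  \dim P = 2.

Definition curve_in (K : fieldType) (d : nat) (P C : {vspace ternary_form K d}) : Prop :=
  \dim C = 1 /\ (C <= P)%VS.

Definition stable_curve (K : fieldType) (d : nat) (C : {vspace ternary_form K d}) :
    Prop :=
  stable (@ternary_form_act K d) C.

Definition strictly_semistable_curve (K : fieldType) (d : nat)
    (C : {vspace ternary_form K d}) : Prop :=
  strictly_semistable (@ternary_form_act K d) C.

Definition stable_pencil (K : fieldType) (d : nat) (P : {vspace ternary_form K d}) :
    Prop :=
  stable (ext2_act (@ternary_form_act K d)) (plucker P).

(* Main.v *)
Require Import Defs.
From HB Require Import structures.
From mathcomp Require Import all_boot all_order all_algebra.
From mathcomp Require Import boolp classical_sets functions cardinality reals.
From mathcomp Require Import perm complex mpoly ring.

Set Implicit Arguments.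
Unset Strict Implicit.
Unset Printing Implicit Defensive.
Import Order.TTheory GRing.Theory Num.Theory.
Local Open Scope classical_set_scope.
Local Open Scope ring_scope.

(** Why the theorem is true.  Write the pencil as spanned by [u] and [v], and
    let [w] be [wedge u v].  Both halves of stability (closed orbit, finite
    stabilizer) follow from one properness property of the orbit map
    g |-> g w: along any degeneration of g for which g w stays finite, g itself
    stays finite.

    A degeneration is made precise by a place.  For a pointed type [T], look at
    sub-C-algebras G of (T -> C) x C that contain the pairs (c, c) and do not
    contain (0, 1); Zorn's lemma provides maximal ones.  A pair (f, a) in a
    maximal G reads: the function f tends to a.  Maximality is the extension
    theorem for places in algebraically closed fields, carried out in the von
    Neumann regular ring of functions T -> C: every f has a limit, or its
    pointwise inverse tends to 0 ([graph_or_inverse]).  Indicator functions then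
    have limit 0 or 1, so that an ultrafilter of almost everywhere true
    properties comes along, and the bounded functions behave as a valuation ring
    with residue field C.  In contrast with a limit for the usual topology, the
    initial pairs may be prescribed by algebraic conditions only, which is what
    the Zariski closure requires.

    - Closed orbit: if y is in the closure of the orbit, the pairs
      (x |-> p (x w), p y), for p a polynomial function, generate a proper
      algebra exactly because polynomials vanishing on the orbit vanish at y.
      In a place extending it x w tends to y; by properness x tends to some g in
      SL3, and y is g w ([orbit_closed]).
    - Finite stabilizer: otherwise some matrix entry takes infinitely many
      values on the stabilizer, there is a place in which this entry has a pole
      while x w = w is constant, and properness is contradicted
      ([stabilizer_finite]).

    Properness itself ([pencil_proper]) is the Hilbert-Mumford argument, with
    the one-parameter subgroup replaced by a diagonal matrix a of functions.
    A Smith form over the bounded functions ([smith_SL]) writes the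
    degeneration, up to a bounded factor on the right, as K diag(a), with K
    tending to some k of determinant 1.  Substituting k in the pencil, the
    hypothesis says that a^m a^m' is bounded as soon as the (m, m') minor of
    the two forms is nonzero.  Let m0 be the monomial of least valuation
    occurring in the pencil and g the member that lacks m0.  The monomials of g
    are those m for which the (m0, m) minor is nonzero, hence their weights are
    nonnegative, g is not stable unless a is bounded, and by assumption it must
    be strictly semistable.  It is not unstable, so some monomial of g has
    weight zero; then m0 has nonnegative weight, and no member of the pencil is
    stable.  That contradicts the assumption that at most one member is not.

    The two facts used about curves are the elementary halves of the criterion:
    a torus degeneration keeps a semistable form away from 0
    ([semistable_not_contracted]), and one under which a stable form stays
    bounded is itself bounded ([stable_torus_bounded]), because otherwise the
    limit form, which is in the closed orbit, is fixed by an infinite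
    one-parameter subgroup. *)
(** * Extension of places in rings of functions *)

Section PlaceExtension.
Variables (T : pointedType) (C : numClosedFieldType).

Notation B := ((T -> C) * C)%type.

Definition const_pair (c : C) : B := (fun=> c, c).

(** The algebra G is the graph of a partially defined C-algebra morphism from
    T -> C to C: if it contained (f, a) and (f, b) with a <> b, then rescaling
    their difference would give (0, 1).  Taking graphs, rather than a subring
    together with a morphism, makes inclusion the extension order. *)
Record limit_graph (G : set B) : Prop := LimitGraph {
  graph_const : forall c, G (const_pair c);
  graph_add : forall z w, G z -> G w -> G (z + w);
  graph_mul : forall z w, G z -> G w -> G (z * w);
  graph_proper : ~ G (0, 1) }.

Definition coeffs_in (G : set B) (p : {poly B}) := forall i, G p`_i.

Definition adjoin (G : set B) (z : B) : set B :=
  [set p.[z] | p in coeffs_in G].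

Lemma graph0 G : limit_graph G -> G 0.
Proof. by move=> /graph_const /(_ 0). Qed.

Lemma graph1 G : limit_graph G -> G 1.
Proof. by move=> /graph_const /(_ 1). Qed.

Lemma graphN G z : limit_graph G -> G z -> G (- z).
Proof.
move=> hG Gz; have := graph_mul hG (graph_const hG (-1)) Gz.
suff -> : const_pair (-1) = -1 by rewrite mulN1r.
by congr (_, _); apply/funext.
Qed.

Lemma graph_sum G (I : Type) (r : seq I) (P : pred I) (F : I -> B) :
  limit_graph G -> (forall i, P i -> G (F i)) -> G (\sum_(i <- r | P i) F i).
Proof.
move=> hG hF; elim/big_ind: _ => //; [exact: graph0 | exact: graph_add].
Qed.

Definition fstp (p : {poly B}) : {poly (T -> C)} := map_poly fst p.
Definition sndp (p : {poly B}) : {poly C} := map_poly snd p.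

Lemma fstpB p q : fstp (p - q) = fstp p - fstp q.
Proof. exact: rmorphB. Qed.
Lemma fstpM p q : fstp (p * q) = fstp p * fstp q.
Proof. exact: rmorphM. Qed.
Lemma fstpC z : fstp z%:P = z.1%:P.
Proof. exact: map_polyC. Qed.
Lemma fstpX : fstp 'X = 'X.
Proof. exact: map_polyX. Qed.
Lemma sndpB p q : sndp (p - q) = sndp p - sndp q.
Proof. exact: rmorphB. Qed.
Lemma sndpM p q : sndp (p * q) = sndp p * sndp q.
Proof. exact: rmorphM. Qed.
Lemma sndpC z : sndp z%:P = z.2%:P.
Proof. exact: map_polyC. Qed.
Lemma coef_sndp p i : (sndp p)`_i = (p`_i).2.
Proof. exact: coef_map. Qed.

Lemma horner_pair (p : {poly B}) f a : p.[(f, a)] = ((fstp p).[f], (sndp p).[a]).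
Proof.
by rewrite [LHS]surjective_pairing -[(p.[_]).1]horner_map -[(p.[_]).2]horner_map.
Qed.

Lemma coeffs_in_C G z : limit_graph G -> G z -> coeffs_in G z%:P.
Proof. by move=> hG Gz i; rewrite coefC; case: ifP => // _; apply: graph0. Qed.

Lemma coeffs_in_X G : limit_graph G -> coeffs_in G 'X.
Proof. by move=> hG i; rewrite coefX; case: eqP => _; [apply: graph1|apply: graph0]. Qed.

Lemma coeffs_in_D G p q : limit_graph G -> coeffs_in G p -> coeffs_in G q -> coeffs_in G (p + q).
Proof. by move=> hG hp hq i; rewrite coefD; apply: graph_add. Qed.

Lemma coeffs_in_N G p : limit_graph G -> coeffs_in G p -> coeffs_in G (- p).
Proof. by move=> hG hp i; rewrite coefN; apply: graphN. Qed.

Lemma coeffs_in_M G p q : limit_graph G -> coeffs_in G p -> coeffs_in G q -> coeffs_in G (p * q).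
Proof.
by move=> hG hp hq i; rewrite coefM; apply: graph_sum => // j _; apply: graph_mul.
Qed.

Definition maximal_graph G :=
  limit_graph G /\ forall G', limit_graph G' -> G `<=` G' -> G' `<=` G.

(** The empty set is thrown in because the lemma of Zorn in use asks for upper
    bounds of all chains, the empty one included. *)
Lemma maximal_graph_exists G0 : limit_graph G0 ->
  exists2 G, maximal_graph G & G0 `<=` G.
Proof.
move=> hG0.
have [|A [[hA|->] maxA]] := @Zorn_bigcup _ [set G | limit_graph G /\ G0 `<=` G \/ G = set0].
- move=> F FP totF.
  have [[G1 [FG1 G1n]]|noF] := pselect (exists G, F G /\ G <> set0).
  + left; have [hG1 G01] : limit_graph G1 /\ G0 `<=` G1 by case: (FP _ FG1).
    have bigger X : F X -> X `<=` \bigcup_(X in F) X by move=> FX z Xz; exists X.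
    have join z w : (\bigcup_(X in F) X) z -> (\bigcup_(X in F) X) w ->
        exists X, [/\ F X, limit_graph X, X z & X w].
      move=> [X FX Xz] [Y FY Yw].
      have hX : limit_graph X.
        by case: (FP _ FX) => [[]//|X0]; rewrite X0 in Xz.
      have hY : limit_graph Y.
        by case: (FP _ FY) => [[]//|X0]; rewrite X0 in Yw.
      by case: (totF _ _ FX FY) => s; [exists Y|exists X]; split => //; apply: s.
    split; last by move=> z /G01 ?; exists G1.
    split.
    * by move=> c; exists G1 => //; apply: graph_const.
    * move=> z w /join h /h [X [FX hX Xz Xw]]; apply: bigger FX _ _; exact: graph_add.
    * move=> z w /join h /h [X [FX hX Xz Xw]]; apply: bigger FX _ _; exact: graph_mul.
    * by move=> h; have [X [_ hX Xz _]] := join _ _ h h; exact: graph_proper hX Xz.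
  + right; apply/seteqP; split => // z [X FX Xz].
    by apply: noF; exists X; split=> // X0; rewrite X0 in Xz.
- case: hA => hA G0A; exists A => //; split => // G' hG' AG' .
  have [//|nG'] := pselect (G' `<=` A); exfalso; apply: (maxA G').
    by split=> // [] /nG'.
  by left; split => //; apply: subset_trans AG'.
- exfalso; apply: (maxA G0); last by left; split.
  split; first by [].
  by move=> /(_ _ (graph0 hG0)).
Qed.

Section Maximal.
Variable (G : set B).
Hypothesis maxG : maximal_graph G.
Let hG : limit_graph G := maxG.1.

(** Adjoining z to a maximal G gains nothing, unless it breaks properness. *)
Lemma adjoin_proper z : (forall p, coeffs_in G p -> p.[z] <> (0, 1)) -> G z.
Proof.
move=> hp; have hadj : limit_graph (adjoin G z).
  split.
  - by move=> c; exists (const_pair c)%:P; [apply: coeffs_in_C => //; apply: graph_const|rewrite hornerC].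
  - move=> _ _ [p hp1 <-] [q hq <-]; exists (p + q); last by rewrite hornerD.
    exact: coeffs_in_D.
  - move=> _ _ [p hp1 <-] [q hq <-]; exists (p * q); last by rewrite hornerM.
    exact: coeffs_in_M.
  - by move=> [p hp1]; apply: hp.
apply: (maxG.2 _ hadj).
  by move=> c Gc; exists c%:P; [apply: coeffs_in_C|rewrite hornerC].
by exists 'X; [apply: coeffs_in_X|rewrite hornerX].
Qed.

(** A function that vanishes wherever c does not must tend to 0 if c tends to 1:
    multiplying by (c, 1) a polynomial relation in (f, 0) leaves only its
    constant term. *)
Lemma graph_annihilated c f : G (c, 1) -> c * f = 0 -> G (f, 0).
Proof.
move=> Gc cf; apply: adjoin_proper => p hp pz.
have [q [d pq]] : exists q d, p = q * 'X + d%:P.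
  by elim/poly_ind: (p) => [|q r _]; [exists 0, 0; rewrite mul0r add0r|exists q, r].
have Gd : G d by have := hp 0; rewrite pq coefD coefMX coefC /= add0r.
move: (graph_mul hG Gc Gd); move: pz; rewrite pq hornerD hornerMX hornerC => /(congr1 ( *%R (c, 1))).
rewrite mulrDr mulrCA.
have -> : (c, 1) * (f, 0) = 0 :> B by congr (_, _); rewrite ?cf ?mulr0.
rewrite mulr0 add0r => ->.
have -> : (c, 1) * (0, 1) = (0, 1) :> B by congr (_, _); rewrite ?mulr0 ?mulr1.
exact: graph_proper.
Qed.


Lemma relation_at f a : ~ G (f, a) ->
  exists2 p, coeffs_in G p & (fstp p).[f] = 0 /\ (sndp p).[a] = 1.
Proof.
move=> nG; apply: contrapT => h; apply: nG; apply: adjoin_proper => p hp.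
by rewrite horner_pair => -[e1 e2]; apply: h; exists p.
Qed.

Let lift_poly (q : {poly C}) : {poly B} := map_poly const_pair q.

Lemma coeffs_in_lift q : coeffs_in G (lift_poly q).
Proof.
by move=> i; rewrite coef_map_id0; [exact: graph_const|].
Qed.

Lemma sndp_lift q : sndp (lift_poly q) = q.
Proof. by apply/polyP => i; rewrite coef_sndp coef_map_id0. Qed.

(** The second components of the relations P over G with P(f) = 0 form an ideal
    of C[X].  If f tends to no a, no a is a common zero of this ideal, which
    therefore contains 1 because C is algebraically closed.  The proof divides
    with remainder to lower the degree of a member of the ideal down to 0. *)
Lemma unit_relation f : (forall a, ~ G (f, a)) ->
  exists2 P, coeffs_in G P & (fstp P).[f] = 0 /\ sndp P = 1.
Proof.
move=> nG.
have [p0 hp0 [p0f p01]] := relation_at (nG 0).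
have : sndp p0 != 0 by apply: contra_eq_neq p01 => ->; rewrite horner0 eq_sym oner_eq0.
move: (leqnn (size (sndp p0))); move: {2}(size _) => n; move: hp0 p0f {p01}.
elim: n p0 => [|n IH] p hp pf.
  by rewrite leqn0 size_poly_eq0 => ->.
move=> sz p0; have [s1|s1] := eqVneq (size (sndp p)) 1.
  have /size_poly1P[c c0 pc] : size (sndp p) == 1 by apply/eqP.
  exists (lift_poly (c^-1)%:P * p); first by apply: coeffs_in_M => //; exact: coeffs_in_lift.
  rewrite fstpM hornerM pf mulr0; split => //.
  by rewrite sndpM sndp_lift pc -polyCM mulVf.
have [a /rootP pa] := closed_rootP _ s1.
have [q hq [qf qa]] := relation_at (nG a).
(* The quotient in C[X] lifts to constant functions, so the remainder is the
   second component of a relation again. *)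
pose r := q - lift_poly (sndp q %/ sndp p) * p.
have er : sndp r = sndp q %% sndp p.
  rewrite sndpB sndpM sndp_lift.
  by rewrite {1}(divp_eq (sndp q) (sndp p)) addrAC subrr add0r.
apply: (IH r).
- apply: coeffs_in_D => //; apply: coeffs_in_N => //; apply: coeffs_in_M => //; exact: coeffs_in_lift.
- by rewrite /r fstpB fstpM hornerD hornerN hornerM qf pf mulr0 subr0.
- by rewrite er -ltnS; apply: leq_trans sz; rewrite ltn_modp.
- apply: contra_eq_neq qa => r0; rewrite (divp_eq (sndp q) (sndp p)) -er r0.
  by rewrite addr0 hornerM pa mulr0 eq_sym oner_eq0.
Qed.

(** Here P is a relation for f whose coefficients tend to (1, 0, ..., 0), and S,
    of formal degree n, is the reversal of a relation for the inverse of f whose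
    constant term tends to 1.  As in the extension theorem for places, the one of
    larger degree is reduced by the other; leading terms are eliminated from P,
    and constant terms from S, so that both shapes are preserved.  The relations
    are only asked to hold after multiplication by f, that is, where f does not
    vanish: pointwise inverses are no more than quasi-inverses. *)
Lemma euclid_relations f (P S : {poly B}) m n :
  coeffs_in G P -> coeffs_in G S -> (size P <= m.+1)%N -> (size S <= n.+1)%N ->
  sndp P = 1 -> (S`_n).2 = 1 ->
  f * (fstp P).[f] = 0 -> f * (fstp S).[f] = 0 -> G (f, 0).
Proof.
move: {2}(m + n)%N (leqnn (m + n)) => k.
elim: k m n P S => [|k IH] m n P S.
  rewrite leqn0 addn_eq0 => /andP[/eqP-> /eqP->] hP hS sP sS P1 S1 fP fS.
  apply: (@graph_annihilated (S`_0).1); first by rewrite -S1 -surjective_pairing.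
  move: fS; rewrite (size1_polyC sS) fstpC hornerC coefC /= mulrC.
  by [].
move=> mnk hP hS sP sS P1 S1 fP fS.
have [m0|m_gt0] := posnP m.
  have P01 : (P`_0).2 = 1.
    by rewrite -coef_sndp P1 coefC.
  apply: (@graph_annihilated (P`_0).1); first by rewrite -P01 -surjective_pairing.
  move: fP; rewrite m0 in sP; rewrite (size1_polyC sP) fstpC hornerC coefC /= mulrC.
  by [].
have [nm|mn] := leqP n m.
  pose P' := (S`_n)%:P * P - (P`_m)%:P * ('X^(m - n) * S).
  apply: (IH m.-1 n P' S) => //.
  - by rewrite -ltnS (leq_trans _ mnk) // -addSn prednK.
  - apply: coeffs_in_D => //; first by apply: coeffs_in_M => //; apply: coeffs_in_C.
    apply: coeffs_in_N => //; apply: coeffs_in_M => //; first exact: coeffs_in_C.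
    apply: coeffs_in_M => //; elim: (m - n)%N => [|j IHj].
      by rewrite expr0; apply: coeffs_in_C => //; apply: graph1.
    by rewrite exprS; apply: coeffs_in_M => //; apply: coeffs_in_X.
  - rewrite prednK //; apply/leq_sizeP => j mj.
    rewrite coefB !coefCM coefXnM.
    have -> : (j < m - n)%N = false by apply/negbTE; rewrite -leqNgt (leq_trans (leq_subr _ _)).
    move: mj; rewrite leq_eqVlt => /predU1P[<-|mj]; first by rewrite subKn // mulrC subrr.
    have -> : P`_j = 0 by move/leq_sizeP: sP; apply.
    have -> : S`_(j - (m - n)) = 0 by move/leq_sizeP: sS; apply; rewrite ltn_subRL subnK.
    by rewrite !mulr0 subrr.
  - rewrite sndpB !sndpM !sndpC P1 mulr1 S1 -coef_sndp P1 coefC.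
    by rewrite gtn_eqF // mul0r subr0.
  - rewrite fstpB !fstpM !fstpC hornerD hornerN !hornerM !hornerC mulrBr.
    rewrite mulrCA fP mulr0 sub0r.
    by rewrite mulrCA [f * (_ * _)]mulrCA fS !mulr0 oppr0.
pose D := (P`_0)%:P * S - (S`_0)%:P * P.
have [S' [d eD]] : exists q d, D = q * 'X + d%:P.
  by elim/poly_ind: (D) => [|q r _]; [exists 0, 0; rewrite mul0r add0r|exists q, r].
have D0 : d = 0.
  have := congr1 (fun p : {poly B} => p`_0) eD.
  by rewrite coefB !coefCM mulrC subrr coefD coefMX coefC /= add0r.
rewrite D0 addr0 in eD.
have coefS' i : S'`_i = D`_i.+1 by rewrite eD coefMX.
have hD : coeffs_in G D.
  apply: coeffs_in_D => //; last apply: coeffs_in_N => //; apply: coeffs_in_M => //; exact: coeffs_in_C.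
have n_gt0 : (0 < n)%N by apply: leq_trans mn.
apply: (IH m n.-1 P S') => //.
- by rewrite -ltnS (leq_trans _ mnk) // -addnS prednK.
- by move=> i; rewrite coefS'.
- rewrite prednK //; apply/leq_sizeP => j nj.
  rewrite coefS' coefB !coefCM.
  have -> : S`_j.+1 = 0 by move/leq_sizeP: sS; apply.
  have -> : P`_j.+1 = 0 by move/leq_sizeP: sP; apply; rewrite ltnS (leq_trans (ltnW mn)).
  by rewrite !mulr0 subrr.
- rewrite coefS' prednK // coefB !coefCM.
  have -> : P`_n = 0 by move/leq_sizeP: sP; apply.
  rewrite mulr0 subr0.
  by rewrite /= S1 mulr1 -coef_sndp P1 coefC.
(* The division by 'X costs a factor f, which can be removed since the ring of
   functions is reduced. *)
have fD : f * (fstp S').[f] * f = 0.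
  rewrite -mulrA -hornerMX -fstpX -fstpM -eD fstpB !fstpM !fstpC hornerD hornerN !hornerM !hornerC mulrBr.
  by rewrite mulrCA fS mulr0 mulrCA fP mulr0 subr0.
apply/funext => x; have := congr1 (fun h : T -> C => h x) fD.
rewrite /= => /eqP; rewrite mulf_eq0 => /orP[/eqP//|/eqP e0].
have -> : (f * (fstp S').[f]) x = f x * (fstp S').[f] x by [].
by rewrite e0 mul0r.
Qed.

Lemma expr_quasi_inverse (A : comNzRingType) (f g : A) i :
  f * f * g = f -> f ^+ i.+1 * g ^+ i = f.
Proof.
move=> fg; elim: i => [|i IH]; first by rewrite expr1 expr0 mulr1.
by rewrite exprSr [g ^+ _]exprSr mulrACA IH mulrA.
Qed.

(** The dichotomy that defines valuation rings. *)
Lemma graph_or_inverse f : (exists a, G (f, a)) \/ G (fun x => (f x)^-1, 0).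
Proof.
have [|nf] := pselect (exists a, G (f, a)); first by left.
right; apply: contrapT => nfV.
have [|P hP [Pf P1]] := @unit_relation f; first by move=> a Ga; apply: nf; exists a.
have [Q hQ [Qf Q1]] := relation_at nfV.
apply: nf; exists 0.
have sQ : (0 < size Q)%N.
  rewrite lt0n size_poly_eq0; apply: contra_eq_neq Q1 => ->.
  by rewrite /sndp map_poly0 horner0 eq_sym oner_eq0.
(* Reversing a relation for the inverse of f gives one for f, up to a factor f.
   *)
pose S := \poly_(i < (size Q).-1.+1) Q`_((size Q).-1 - i).
apply: (@euclid_relations f P S (size P) (size Q).-1) => //.
- by move=> i; rewrite coef_poly; case: ifP => // _; apply: graph0.
- exact: size_poly.
- by rewrite coef_poly ltnSn subnn -coef_sndp -horner_coef0.
- by rewrite Pf mulr0.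
rewrite (@horner_coef_wide _ (size Q).-1.+1); last first.
  by apply: leq_trans (size_poly _ _) _; exact: size_poly.
rewrite (reindex_inj rev_ord_inj) /= mulr_sumr.
pose n := (size Q).-1; rewrite -/n.
transitivity (f ^+ n.+1 * (fstp Q).[fun x => (f x)^-1]); last by rewrite Qf mulr0.
rewrite (@horner_coef_wide _ n.+1); last first.
  by rewrite prednK //; exact: size_poly.
rewrite mulr_sumr; apply: eq_bigr => i _.
have fg : f * f * (fun x => (f x)^-1) = f.
  apply/funext => x; have [fx0|fx0] := eqVneq (f x) 0.
    by rewrite !fctE fx0 !mul0r.
  by rewrite !fctE mulfK.
have le_in : (i <= n)%N by rewrite -ltnS.
rewrite subSS /fstp !coef_map coef_poly ltnS leq_subr subKn //.
rewrite mulrCA [RHS]mulrCA; congr (_ * _).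
have -> : f ^+ n.+1 = f ^+ (n - i) * f ^+ i.+1 by rewrite -exprD addnS subnK.
rewrite -mulrA expr_quasi_inverse //.
exact: mulrC.
Qed.

End Maximal.
End PlaceExtension.

(** * Limits, almost everywhere properties and divisibility *)

Section Limits.
Variables (T : pointedType) (C : numClosedFieldType).
Variable (G : set ((T -> C) * C)).

Definition lim (f : T -> C) (a : C) := G (f, a).

Definition bounded (f : T -> C) := exists a, lim f a.

(** The properties true almost everywhere form an ultrafilter, see [ae_and],
    [ae_mono] and [ae_em]. *)
Definition ae (P : T -> Prop) := lim (fun x => (`[< P x >])%:R) 1.

Hypothesis maxG : maximal_graph G.
Let hG : limit_graph G := maxG.1.

Lemma lim_const c : lim (fun=> c) c.
Proof. exact: graph_const. Qed.

Lemma lim_ext f g a : f =1 g -> lim f a -> lim g a.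
Proof. by move=> /funext->. Qed.

Lemma limD f g a b : lim f a -> lim g b -> lim (fun x => f x + g x) (a + b).
Proof. by move=> /(graph_add hG) h /h. Qed.

Lemma limM f g a b : lim f a -> lim g b -> lim (fun x => f x * g x) (a * b).
Proof. by move=> /(graph_mul hG) h /h. Qed.

Lemma limN f a : lim f a -> lim (fun x => - f x) (- a).
Proof. exact: graphN. Qed.

Lemma limB f g a b : lim f a -> lim g b -> lim (fun x => f x - g x) (a - b).
Proof. by move=> /limD h /limN /h. Qed.

Lemma lim_sum (I : Type) (r : seq I) (P : pred I) (F : I -> T -> C) (A : I -> C) :
  (forall i, P i -> lim (F i) (A i)) ->
  lim (fun x => \sum_(i <- r | P i) F i x) (\sum_(i <- r | P i) A i).
Proof.
move=> h; elim: r => [|i r IH].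
  by under eq_fun do rewrite big_nil; rewrite big_nil; exact: lim_const.
under eq_fun do rewrite big_cons; rewrite big_cons.
by case: ifPn => // Pi; apply: limD => //; apply: h.
Qed.

Lemma lim_prod (I : Type) (r : seq I) (P : pred I) (F : I -> T -> C) (A : I -> C) :
  (forall i, P i -> lim (F i) (A i)) ->
  lim (fun x => \prod_(i <- r | P i) F i x) (\prod_(i <- r | P i) A i).
Proof.
move=> h; elim: r => [|i r IH].
  by under eq_fun do rewrite big_nil; rewrite big_nil; exact: lim_const.
under eq_fun do rewrite big_cons; rewrite big_cons.
by case: ifPn => // Pi; apply: limM => //; apply: h.
Qed.

Lemma limX f a n : lim f a -> lim (fun x => f x ^+ n) (a ^+ n).
Proof.
move=> fa; elim: n => [|n IH]; first exact: lim_const.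
by under eq_fun do rewrite exprS; rewrite exprS; apply: limM.
Qed.

Lemma lim_uniq f a b : lim f a -> lim f b -> a = b.
Proof.
move=> fa /(limB fa) fab; apply/eqP; rewrite -subr_eq0; apply: contrapT => /negP ab.
apply: (graph_proper hG); rewrite -/(lim _ _).
have := limM fab (lim_const (a - b)^-1); rewrite divff //.
by under eq_fun do rewrite subrr mul0r.
Qed.

Lemma lim_null P f : ae P -> (forall x, P x -> f x = 0) -> lim f 0.
Proof.
move=> aeP f0; apply: (graph_annihilated maxG aeP); apply/funext => x.
rewrite fctE; case: asboolP => [/f0 ->|_]; first exact: mulr0.
exact: mul0r.
Qed.

(** Limits only depend on the behaviour almost everywhere: a function that is
    zero almost everywhere tends to 0. *)
Lemma lim_ae P f g a :
  ae P -> (forall x, P x -> f x = g x) -> lim f a -> lim g a.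
Proof.
move=> aeP fg fa.
have gf : lim (fun x => g x - f x) 0.
  by apply: lim_null aeP _ => x /fg ->; rewrite subrr.
have := limD fa gf; rewrite addr0; apply: lim_ext => x. by rewrite addrC subrK.
Qed.

Lemma bounded_ae P f g :
  ae P -> (forall x, P x -> f x = g x) -> bounded f -> bounded g.
Proof. by move=> aeP fg [a fa]; exists a; exact: lim_ae aeP fg fa. Qed.

Lemma ae_mono (P Q : T -> Prop) : (forall x, P x -> Q x) -> ae P -> ae Q.
Proof.
move=> PQ aeP; apply: (lim_ae aeP) (aeP) => x Px.
by rewrite !asboolT//; exact: PQ.
Qed.

Lemma ae_and (P Q : T -> Prop) : ae P -> ae Q -> ae (fun x => P x /\ Q x).
Proof.
move=> aeP aeQ; have := limM aeP aeQ; rewrite mulr1; apply: lim_ext => x.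
by rewrite asbool_and; case: `[<_>]; case: `[<_>]; rewrite ?mulr1n ?mulr0n ?mulr1 ?mulr0.
Qed.

Lemma ae_true P : (forall x, P x) -> ae P.
Proof.
move=> h; rewrite /ae; under eq_fun do rewrite asboolT //.
exact: lim_const.
Qed.

Lemma bounded_or_pole f : bounded f \/ lim (fun x => (f x)^-1) 0.
Proof. exact: graph_or_inverse. Qed.

Lemma limV f a : a != 0 -> lim f a -> lim (fun x => (f x)^-1) a^-1.
Proof.
move=> a0 fa; have [[b fb]|] := bounded_or_pole (fun x => (f x)^-1); last first.
  under eq_fun do rewrite invrK.
  by move=> /(lim_uniq fa) /eqP; rewrite (negPf a0).
suff -> : a^-1 = b by [].
have := limM fa (limM fa fb).
have -> : (fun x => f x * (f x * (f x)^-1)) = f.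
  by apply/funext => x; have [->|fx] := eqVneq (f x) 0; rewrite ?mul0r // divff ?mulr1.
move=> /(lim_uniq fa) e; apply: (mulfI a0); apply: (mulfI a0).
by rewrite -e divff ?mulr1.
Qed.

Lemma ae_neq0 f a : a != 0 -> lim f a -> ae (fun x => f x != 0).
Proof.
move=> a0 fa; have := limM fa (limV a0 fa); rewrite divff //; apply: lim_ext => x.
rewrite asboolb; have [->|fx] := eqVneq (f x) 0.
  by rewrite mul0r.
by rewrite divff.
Qed.

(** The limit of an indicator function is idempotent. *)
Lemma ae_em P : ae P \/ ae (fun x => ~ P x).
Proof.
have [[a Pa]|P0] := bounded_or_pole (fun x => (`[<P x>])%:R).
- have : a * a = a.
    apply: lim_uniq (limM Pa Pa) _; apply: lim_ext Pa => x.
    by case: `[<_>]; rewrite ?mulr1n ?mulr0n ?mulr1 ?mulr0.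
  have [a0 _|a0 aa] := eqVneq a 0.
    right; have := limB (lim_const 1) Pa; rewrite a0 subr0; apply: lim_ext => x.
    by rewrite asbool_neg; case: `[<_>]; rewrite ?mulr1n ?mulr0n ?subr0 ?subrr.
  have a1 : a = 1 by apply: (mulfI a0); rewrite aa mulr1.
  by left; rewrite a1 in Pa.
- right; have := limB (lim_const 1) P0; rewrite subr0; apply: lim_ext => x.
  by rewrite asbool_neg; case: `[<_>]; rewrite ?mulr1n ?mulr0n ?invr0 ?invr1 ?subr0 ?subrr.
Qed.

(** Divisibility for the valuation, up to a null set: the second clause handles
    the points where division by f is meaningless. *)
Definition dvd (f g : T -> C) :=
  bounded (fun x => g x / f x) /\ ae (fun x => f x = 0 -> g x = 0).

Lemma dvd_total f g : dvd f g \/ dvd g f.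
Proof.
have zero h : ae (fun x => h x = 0) -> forall k, dvd k h.
  move=> h0 k; split; last by apply: ae_mono h0.
  by exists 0; apply: lim_null h0 _ => x ->; rewrite mul0r.
have [/zero ?|nf] := ae_em (fun x => f x = 0); first by right.
have [/zero ?|ng] := ae_em (fun x => g x = 0); first by left.
have [b|p] := bounded_or_pole (fun x => g x / f x).
  by left; split => //; apply: ae_mono nf.
right; split; last by apply: ae_mono ng.
by exists 0; move: p; under eq_fun do rewrite invf_div.
Qed.

Lemma bounded0 : bounded (fun=> 0). Proof. by exists 0; exact: lim_const. Qed.

Lemma boundedM f g : bounded f -> bounded g -> bounded (fun x => f x * g x).
Proof. by move=> [a fa] [b gb]; exists (a * b); apply: limM. Qed.

Lemma dvd_trans g f h : dvd f g -> dvd g h -> dvd f h.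
Proof.
move=> [bf af] [bg ag]; split; last first.
  by apply: ae_mono (ae_and af ag) => x [fg gh] /fg /gh.
apply: (bounded_ae ag) (boundedM bg bf) => x gh.
have [g0|g0] := eqVneq (g x) 0; first by rewrite g0 (gh g0) !mul0r.
by rewrite mulrA divfK.
Qed.

(** Divisibility is a total preorder, so a finite family has an element of least
    valuation. *)
Lemma dvd_min (I : eqType) (s : seq I) (F : I -> T -> C) :
  s != [::] -> exists2 i, i \in s & forall j, j \in s -> dvd (F i) (F j).
Proof.
have dvd_refl f : dvd f f by case: (dvd_total f f).
elim: s => // i s IH _; have [->|/IH [k ks kmin]] := eqVneq s [::].
  by exists i; rewrite ?mem_head // => j; rewrite inE => /eqP->.
have [ik|ki] := dvd_total (F i) (F k); last first.
  by exists k; rewrite ?inE ?ks ?orbT // => j; rewrite inE => /predU1P[->|/kmin].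
exists i; rewrite ?mem_head // => j; rewrite inE => /predU1P[->//|/kmin].
exact: dvd_trans.
Qed.

End Limits.

(** * Smith form over the bounded functions *)

Section Matrices.
Variables (T : pointedType) (C : numClosedFieldType).
Variable (G : set ((T -> C) * C)).
Hypothesis maxG : maximal_graph G.

Notation lim := (lim G).
Notation bounded := (bounded G).
Notation ae := (ae G).

Lemma ae_all (I : finType) (P : I -> T -> Prop) :
  (forall i, ae (P i)) -> ae (fun x => forall i, P i x).
Proof.
move=> aeP.
suff h (s : seq I) : ae (fun x => forall i, i \in s -> P i x).
  by apply: (ae_mono maxG _ (h (enum I))) => x hx i; apply: hx; rewrite mem_enum.
elim: s => [|i s IH]; first by apply: (ae_true maxG).
apply: (ae_mono maxG _ (ae_and maxG (aeP i) IH)) => x [Pi Ps] j.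
by rewrite inE => /predU1P[->|/Ps].
Qed.

Definition lim_mx m n (F : T -> 'M[C]_(m, n)) (A : 'M[C]_(m, n)) :=
  forall i j, lim (fun x => F x i j) (A i j).

Definition bounded_mx m n (F : T -> 'M[C]_(m, n)) :=
  forall i j, bounded (fun x => F x i j).

Lemma bounded_mx_lim m n (F : T -> 'M[C]_(m, n)) :
  bounded_mx F -> exists A, lim_mx F A.
Proof.
move=> bF; exists (\matrix_(i, j) projT1 (cid (bF i j))) => i j.
by rewrite mxE; case: (cid _).
Qed.

Lemma lim_mx_bounded m n (F : T -> 'M[C]_(m, n)) A :
  lim_mx F A -> bounded_mx F.
Proof. by move=> FA i j; exists (A i j). Qed.

Lemma lim_mx_const m n (A : 'M[C]_(m, n)) : lim_mx (fun=> A) A.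
Proof. by move=> i j; exact: (lim_const maxG). Qed.

Lemma lim_mulmx m n p (F : T -> 'M[C]_(m, n)) (H : T -> 'M[C]_(n, p)) A B :
  lim_mx F A -> lim_mx H B -> lim_mx (fun x => F x *m H x) (A *m B).
Proof.
move=> FA HB i j; rewrite mxE; under eq_fun do rewrite mxE.
by apply: (lim_sum maxG) => k _; apply: (limM maxG).
Qed.

Lemma bounded_mulmx m n p (F : T -> 'M[C]_(m, n)) (H : T -> 'M[C]_(n, p)) :
  bounded_mx F -> bounded_mx H -> bounded_mx (fun x => F x *m H x).
Proof.
move=> /bounded_mx_lim[A FA] /bounded_mx_lim[B HB].
exact: lim_mx_bounded (lim_mulmx FA HB).
Qed.

Lemma lim_det n (F : T -> 'M[C]_n) A :
  lim_mx F A -> lim (fun x => \det (F x)) (\det A).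
Proof.
move=> FA; apply: (lim_sum maxG) => s _; apply: (limM maxG); first exact: (lim_const maxG).
by apply: (lim_prod maxG) => i _.
Qed.

Lemma bounded_mx_ae m n P (F H : T -> 'M[C]_(m, n)) :
  ae P -> (forall x, P x -> F x = H x) -> bounded_mx F -> bounded_mx H.
Proof.
by move=> aeP FH bF i j; apply: (bounded_ae maxG aeP _ (bF i j)) => x /FH ->.
Qed.

Lemma bounded_block m1 m2 n1 n2 (A : T -> 'M[C]_(m1, n1)) (B : T -> 'M[C]_(m1, n2))
    (D : T -> 'M[C]_(m2, n1)) (E : T -> 'M[C]_(m2, n2)) :
  bounded_mx A -> bounded_mx B -> bounded_mx D -> bounded_mx E ->
  bounded_mx (fun x => block_mx (A x) (B x) (D x) (E x)).
Proof.
move=> bA bB bD bE i j.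
by case: (split_ordP i) => i' ->; case: (split_ordP j) => j' ->;
  [under eq_fun do rewrite block_mxEul | under eq_fun do rewrite block_mxEur
  |under eq_fun do rewrite block_mxEdl | under eq_fun do rewrite block_mxEdr].
Qed.

(** With determinant 1 the inverse is the adjugate, a polynomial. *)
Lemma lim_invmx n (F : T -> 'M[C]_n) A :
  ae (fun x => \det (F x) = 1) -> lim_mx F A ->
  \det A = 1 /\ lim_mx (fun x => invmx (F x)) (invmx A).
Proof.
move=> detF FA.
have detA : \det A = 1.
  apply: (lim_uniq maxG (lim_det FA)).
  by apply: (lim_ae maxG detF _ (lim_const maxG 1)) => x ->.
split=> // i j.
have inv1 (M : 'M[C]_n) : \det M = 1 -> invmx M = \adj M.
  by move=> dM; rewrite /invmx unitmxE dM unitr1 invr1 scale1r.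
rewrite inv1 //; apply: (lim_ae maxG detF (f := fun x => (\adj (F x)) i j)).
  by move=> x /inv1 ->.
rewrite mxE; under eq_fun do rewrite mxE.
apply: (limM maxG); first exact: (lim_const maxG).
apply: lim_det => k l; rewrite !mxE; under eq_fun do rewrite !mxE.
exact: FA.
Qed.

(** The elements of GL_n of the ring of bounded functions. *)
Record unimodular n (F : T -> 'M[C]_n) : Prop := Unimodular {
  unimodular_unit : forall x, F x \in unitmx;
  unimodular_bounded : bounded_mx F;
  unimodular_inv : bounded_mx (fun x => invmx (F x)) }.

Lemma unimodular_intro n (F H : T -> 'M[C]_n) :
  (forall x, F x *m H x = 1%:M) -> bounded_mx F -> bounded_mx H -> unimodular F.
Proof.
move=> FH bF bH; have uF x : F x \in unitmx by case: (mulmx1_unit (FH x)).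
split=> // i j; have [a Ha] := bH i j; exists a; apply: lim_ext Ha => x.
by rewrite -[H x](mulKmx (uF x)) FH mulmx1.
Qed.

Lemma unimodularM n (F H : T -> 'M[C]_n) :
  unimodular F -> unimodular H -> unimodular (fun x => F x *m H x).
Proof.
move=> [uF bF iF] [uH bH iH].
apply: (@unimodular_intro _ _ (fun x => invmx (H x) *m invmx (F x))).
- by move=> x; rewrite mulmxA mulmxK // mulmxV.
- exact: bounded_mulmx.
- exact: bounded_mulmx.
Qed.

Lemma unimodular_inverse n (F : T -> 'M[C]_n) :
  unimodular F -> unimodular (fun x => invmx (F x)).
Proof.
move=> [uF bF iF]; apply: (@unimodular_intro _ _ F) => // x.
exact: mulVmx.
Qed.

Lemma bounded_mx_const m n (A : 'M[C]_(m, n)) : bounded_mx (fun=> A).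
Proof. exact: lim_mx_bounded (lim_mx_const A). Qed.

Lemma unimodular_const n (A : 'M[C]_n) : A \in unitmx -> unimodular (fun=> A).
Proof. by move=> uA; split => //; apply: bounded_mx_const. Qed.

Lemma bounded_opp m n (F : T -> 'M[C]_(m, n)) :
  bounded_mx F -> bounded_mx (fun x => - F x).
Proof.
move=> bF i j; have [a Fa] := bF i j; exists (- a); under eq_fun do rewrite mxE.
exact: (limN maxG).
Qed.

Lemma unimodular_ldown n (c : T -> 'cV[C]_n) : bounded_mx c ->
  unimodular (fun x => block_mx (1%:M : 'M_1) 0 (c x) 1%:M).
Proof.
move=> bc; apply: (@unimodular_intro _ _ (fun x => block_mx 1%:M 0 (- c x) 1%:M)).
- by move=> x; rewrite mulmx_block !(mulmx0, mul0mx, mulmx1, mul1mx, addr0, add0r) subrr -scalar_mx_block.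
- by apply: bounded_block => //; exact: bounded_mx_const.
- by apply: bounded_block; try exact: bounded_mx_const; exact: bounded_opp.
Qed.

Lemma unimodular_rup n (r : T -> 'rV[C]_n) : bounded_mx r ->
  unimodular (fun x => block_mx (1%:M : 'M_1) (r x) 0 1%:M).
Proof.
move=> bc; apply: (@unimodular_intro _ _ (fun x => block_mx 1%:M (- r x) 0 1%:M)).
- by move=> x; rewrite mulmx_block !(mulmx0, mul0mx, mulmx1, mul1mx, addr0, add0r) addNr -scalar_mx_block.
- by apply: bounded_block => //; exact: bounded_mx_const.
- by apply: bounded_block; try exact: bounded_mx_const; exact: bounded_opp.
Qed.

Lemma unimodular_drblock n (L : T -> 'M[C]_n) : unimodular L ->
  unimodular (fun x => block_mx (1%:M : 'M_1) 0 0 (L x)).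
Proof.
move=> [uL bL iL].
apply: (@unimodular_intro _ _ (fun x => block_mx 1%:M 0 0 (invmx (L x)))).
- by move=> x; rewrite mulmx_block !(mulmx0, mul0mx, mulmx1, mul1mx, addr0, add0r) mulmxV // -scalar_mx_block.
- by apply: bounded_block => //; exact: bounded_mx_const.
- by apply: bounded_block => //; exact: bounded_mx_const.
Qed.

(** An entry of least valuation is moved to the corner; the quotients of its row
    and column by it are bounded and clear them by unimodular operations. *)
Lemma smith_form n (h : T -> 'M[C]_n) : exists L R (d : T -> 'rV[C]_n),
  [/\ unimodular L, unimodular R &
      ae (fun x => L x *m h x *m R x = diag_mx (d x))].
Proof.
elim: n h => [|n IH] h.
  exists (fun=> 1%:M), (fun=> 1%:M), (fun=> 0); split.
  - exact/unimodular_const/unitmx1.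
  - exact/unimodular_const/unitmx1.
  - by apply: (ae_true maxG) => x; apply/matrixP => -[].
have [|[i0 j0] _ min_ij] := dvd_min maxG (s := enum {: 'I_n.+1 * 'I_n.+1})
  (fun ij x => h x ij.1 ij.2).
  by apply/eqP => /(congr1 size); rewrite -cardE card_prod card_ord.
have [h1 [h1D dvd_h1]] : exists h1 : T -> 'M[C]_(1 + n),
    (forall x, h1 x = tperm_mx 0 i0 *m h x *m tperm_mx 0 j0) /\
    forall i j, dvd G (fun x => h1 x 0 0) (fun x => h1 x i j).
  exists (fun x => tperm_mx 0 i0 *m h x *m tperm_mx 0 j0); split=> // i j.
  have h1E i' j' x : (tperm_mx 0 i0 *m h x *m tperm_mx 0 j0) i' j' =
      h x (tperm 0 i0 i') (tperm 0 j0 j').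
    by rewrite -xrowE -xcolE !mxE.
  under eq_fun do rewrite h1E; under [X in dvd _ _ X]eq_fun do rewrite h1E.
  by rewrite !tpermL; apply: (min_ij (_, _)); rewrite mem_enum.
pose p x := h1 x 0 0.
(* The multipliers of the elimination step are bounded by the choice of the
   pivot. *)
pose c x : 'cV[C]_n := \col_i (dlsubmx (h1 x) i 0 / p x).
pose r x : 'rV[C]_n := \row_i (ursubmx (h1 x) 0 i / p x).
have bc : bounded_mx c.
  move=> i j; have [b _] := dvd_h1 (rshift 1 i) (lshift n 0).
  by under eq_fun do rewrite mxE mxE mxE.
have br : bounded_mx r.
  move=> i j; have [b _] := dvd_h1 (lshift n 0) (rshift 1 j).
  by under eq_fun do rewrite mxE mxE mxE.
have pivot : ae (fun x => dlsubmx (h1 x) = c x *m (p x)%:M /\ ursubmx (h1 x) = p x *: r x).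
  have all0 : ae (fun x => forall ij, p x = 0 -> h1 x ij.1 ij.2 = 0).
    by apply: ae_all => ij; case: (dvd_h1 ij.1 ij.2).
  have cancel (a b : C) : (b = 0 -> a = 0) -> a = a / b * b.
    by have [->/(_ erefl)->|b0 _] := eqVneq b 0; rewrite ?mul0r ?divfK.
  apply: (ae_mono maxG _ all0) => x px; split.
    apply/matrixP => i j; rewrite mul_mx_scalar !mxE (ord1 j) mulrC; apply: cancel => /px.
    by move=> /(_ (rshift 1 i, lshift n 0)).
  apply/matrixP => i j; rewrite !mxE (ord1 i) mulrC; apply: cancel => /px.
  by move=> /(_ (lshift n 0, rshift 1 j)).
have [L [R [d [uL uR LR]]]] := IH (fun x => drsubmx (h1 x) - c x *m ursubmx (h1 x)).
have uP i : unimodular (fun=> tperm_mx 0 i : 'M[C]_n.+1).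
  by apply: unimodular_const; exact: unitmx_perm.
exists (fun x => block_mx 1%:M 0 0 (L x) *m block_mx 1%:M 0 (- c x) 1%:M *m tperm_mx 0 i0).
exists (fun x => tperm_mx 0 j0 *m block_mx 1%:M (- r x) 0 1%:M *m block_mx 1%:M 0 0 (R x)).
exists (fun x => row_mx (p x)%:M (d x)); split.
- apply: unimodularM (uP _); apply: unimodularM; first exact: unimodular_drblock.
  by apply: unimodular_ldown; exact: bounded_opp.
- apply: unimodularM; last exact: unimodular_drblock.
  apply: unimodularM (uP _) _; by apply: unimodular_rup; exact: bounded_opp.
apply: (ae_mono maxG _ (ae_and maxG pivot LR)) => x [[e1 e2] e3].
transitivity (block_mx (1%:M : 'M_1) 0 0 (L x) *m
    (block_mx 1%:M 0 (- c x) 1%:M *m h1 x *m block_mx 1%:M (- r x) 0 1%:M) *m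
    block_mx (1%:M : 'M_1) 0 0 (R x)).
  by rewrite h1D !mulmxA.
have e0 : ulsubmx (h1 x) = (p x)%:M.
  apply/matrixP => i j; rewrite !mxE !ord1 eqxx mulr1n; congr (h1 x _ _); exact: val_inj.
apply: eq_trans _ (esym (diag_mx_row (p x)%:M (d x))).
rewrite -[h1 x]submxK !mulmx_block e0 e1.
rewrite !(mulmx0, mul0mx, mulmx1, mul1mx, addr0, add0r, mulNmx, mulmxN).
rewrite -e3; congr block_mx.
- by apply/matrixP => i j; rewrite !mxE !ord1.
- by rewrite e2 mul_scalar_mx addNr mul0mx.
- by rewrite addNr mulmx0.
- by rewrite addNr mul0mx oppr0 add0r [- _ + _]addrC.
Qed.

End Matrices.

Section SmithSL.
Variables (T : pointedType) (C : numClosedFieldType).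
Variable (G : set ((T -> C) * C)).
Hypothesis maxG : maximal_graph G.

Definition head_scaling n (u : C) : 'M[C]_n.+1 :=
  diag_mx (\row_i (if i == 0 then u else 1)).

Lemma det_head_scaling n u : \det (head_scaling n u) = u.
Proof.
rewrite det_diag (bigD1 ord0) //= mxE eqxx big1 ?mulr1 // => i /negPf i0.
by rewrite mxE i0.
Qed.

Lemma mul_head_scaling n u v : head_scaling n u *m head_scaling n v = head_scaling n (u * v).
Proof.
rewrite mulmx_diag; congr diag_mx; apply/rowP => i; rewrite !mxE.
by case: ifP => _; rewrite ?mulr1.
Qed.

Lemma head_scaling1 n : head_scaling n 1 = 1%:M.
Proof.
rewrite -diag_const_mx; congr diag_mx; apply/rowP => i; rewrite !mxE.
by case: ifP.
Qed.

Lemma unimodular_head_scaling n (u : T -> C) :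
  (forall x, u x != 0) -> bounded G u -> bounded G (fun x => (u x)^-1) ->
  unimodular G (fun x => head_scaling n (u x)).
Proof.
have bnd (v : T -> C) : bounded G v -> bounded_mx G (fun x => head_scaling n (v x)).
  move=> bv i j; under eq_fun do rewrite mxE mxE.
  have [_|_] := eqVneq i j; last by exists 0; exact: (lim_const maxG).
  under eq_fun do rewrite mulr1n.
  by case: (i == 0) => //; exists 1; exact: (lim_const maxG).
move=> u0 bu biu; apply: (@unimodular_intro _ _ G _ _ (fun x => head_scaling n (u x)^-1)).
- by move=> x; rewrite mul_head_scaling divff // head_scaling1.
- exact: bnd.
- exact: bnd.
Qed.

(** A diagonal factor of determinant 1 and a left factor in SL_n: the
    determinants of the unimodular factors are units and can be moved through the
    first diagonal entry. *)
Lemma smith_SL n (h : T -> 'M[C]_n.+1) : ae G (fun x => \det (h x) = 1) ->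
  exists (K N : T -> 'M[C]_n.+1) (a : T -> 'rV[C]_n.+1),
    [/\ forall x, \det (K x) = 1, bounded_mx G K, unimodular G N &
        ae G (fun x => h x *m N x = K x *m diag_mx (a x) /\ \prod_i a x 0 i = 1)].
Proof.
move=> det_h; have [L [R [d [uL uR LR]]]] := smith_form maxG h.
have det_neq0 (F : T -> 'M[C]_n.+1) x : unimodular G F -> \det (F x) != 0.
  by case=> uF _ _; rewrite -unitfE -unitmxE.
have detV_bounded (F : T -> 'M[C]_n.+1) : unimodular G F ->
    bounded G (fun x => (\det (F x))^-1).
  case=> _ _ /bounded_mx_lim[A FA]; exists (\det A).
  by apply: lim_ext (lim_det maxG FA) => x; rewrite det_inv.
have det_bounded (F : T -> 'M[C]_n.+1) : unimodular G F ->
    bounded G (fun x => \det (F x)).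
  by case=> _ /bounded_mx_lim[A FA] _; exists (\det A); exact: lim_det.
have uK : unimodular G (fun x => invmx (L x) *m head_scaling n (\det (L x))).
  apply: (unimodularM maxG); first exact: unimodular_inverse.
  apply: unimodular_head_scaling; [by move=> x; exact: det_neq0| exact: det_bounded|exact: detV_bounded].
have uN : unimodular G (fun x => R x *m head_scaling n (\det (R x))^-1).
  apply: (unimodularM maxG) => //.
  apply: unimodular_head_scaling; [by move=> x; rewrite invr_eq0; exact: det_neq0|exact: detV_bounded|].
  by under eq_fun do rewrite invrK; exact: det_bounded.
exists (fun x => invmx (L x) *m head_scaling n (\det (L x))).
exists (fun x => R x *m head_scaling n (\det (R x))^-1).
pose a x : 'rV[C]_n.+1 := \row_i ((if i == 0 then (\det (L x))^-1 * (\det (R x))^-1 else 1) * d x 0 i).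
exists a; split => //.
- by move=> x; rewrite det_mulmx det_head_scaling det_inv mulVf // det_neq0.
- by case: uK.
have diag_a x : diag_mx (a x) = head_scaling n (\det (L x))^-1 *m (diag_mx (d x) *m head_scaling n (\det (R x))^-1).
  rewrite !mulmx_diag; congr diag_mx; apply/rowP => i; rewrite !mxE.
  by case: ifP => _; rewrite ?mul1r ?mulr1 // mulrAC -mulrA.
apply: (ae_mono maxG _ (ae_and maxG det_h LR)) => x [det_hx LRx]; split.
  rewrite diag_a -LRx !mulmxA -[_ *m head_scaling n (\det _) *m _]mulmxA mul_head_scaling.
  rewrite divff ?det_neq0 // head_scaling1 mulmx1 mulVmx ?mul1mx //.
  by case: uL.
have := det_diag (a x); rewrite diag_a -LRx !det_mulmx det_hx !det_head_scaling mulr1 => <-.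
by rewrite mulrA mulrA mulVf ?mul1r ?divff ?det_neq0.
Qed.
End SmithSL.

(** * Limits of vectors *)

Section Vectors.
Variables (T : pointedType) (C : numClosedFieldType).
Variable (G : set ((T -> C) * C)).
Hypothesis maxG : maximal_graph G.

Notation lim := (lim G).
Notation bounded := (bounded G).
Notation ae := (ae G).

Definition lim_vec (W : vectType C) (F : T -> W) (y : W) :=
  forall i, lim (fun x => coord (vbasis {:W}) i (F x)) (coord (vbasis {:W}) i y).

Lemma scalar_coord (W : vectType C) (l : W -> C) (w : W) : scalar l ->
  l w = \sum_i coord (vbasis {:W}) i w * l (vbasis {:W})`_i.
Proof.
move=> hl.
have l0 : l 0 = 0.
  by have := hl (-1) 0 0; rewrite scaler0 addr0 mulN1r addNr.
rewrite {1}(coord_vbasis (memvf w)).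
elim: (index_enum _) => [|i s IH]; first by rewrite !big_nil.
by rewrite !big_cons hl IH.
Qed.

Lemma lim_scalar (W : vectType C) (l : W -> C) (F : T -> W) y :
  scalar l -> lim_vec F y -> lim (fun x => l (F x)) (l y).
Proof.
move=> hl Fy; rewrite (scalar_coord y hl); under eq_fun do rewrite (scalar_coord _ hl).
apply: (lim_sum maxG) => i _; apply: (limM maxG) => //; exact: (lim_const maxG).
Qed.

Lemma lim_polyfun (W : vectType C) p (F : T -> W) y :
  lim_vec F y -> lim (fun x => polyfun p (F x)) (polyfun p y).
Proof.
move=> Fy; rewrite /polyfun mevalE; under eq_fun do rewrite mevalE.
apply: (lim_sum maxG) => m _; apply: (limM maxG); first exact: (lim_const maxG).
by apply: (lim_prod maxG) => i _; apply: (limX maxG).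
Qed.

Lemma lim_vec_ae (W : vectType C) P (F H : T -> W) y :
  ae P -> (forall x, P x -> F x = H x) -> lim_vec F y -> lim_vec H y.
Proof.
by move=> aeP FH Fy i; apply: (lim_ae maxG aeP _ (Fy i)) => x /FH ->.
Qed.

(** A polynomial vanishing on A vanishes almost everywhere along F, hence at the
    limit. *)
Lemma lim_vec_closure (W : vectType C) (A : set W) (F : T -> W) y :
  ae (fun x => A (F x)) -> lim_vec F y -> zariski_closure A y.
Proof.
move=> AF Fy p pA; apply: (lim_uniq maxG (lim_polyfun p Fy)).
by apply: (lim_null maxG AF) => x /pA.
Qed.

End Vectors.

(** * Linear substitutions in ternary forms *)

Section Substitution.
Variables (C : fieldType) (d : nat).
Notation form := (ternary_form C d).
Implicit Types (f g : form) (A B : 'M[C]_3).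

Definition subst_form A f : form :=
  DHomog (comp_linear_forms_homog A (dhomog_is_dhomog f)).

Lemma subst_form_linear A : linear (subst_form A).
Proof.
by move=> c f g; apply: val_inj; rewrite /= comp_mpolyD comp_mpolyZ.
Qed.

Lemma comp_mpolyA (p : {mpoly C[3]}) (u v : 3.-tuple {mpoly C[3]}) :
  (p \mPo u) \mPo v = p \mPo [tuple (tnth u i) \mPo v | i < 3].
Proof.
rewrite (comp_mpolyE p u) (comp_mpolyE p) raddf_sum /=.
apply: eq_bigr => m _; rewrite comp_mpolyZ rmorph_prod /=; congr (_ *: _).
by apply: eq_bigr => i _; rewrite rmorphXn /= tnth_mktuple.
Qed.

Lemma subst_formM A B f : subst_form (A *m B) f = subst_form B (subst_form A f).
Proof.
apply: val_inj; rewrite /= comp_mpolyA; congr (_ \mPo _).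
apply: eq_from_tnth => i; rewrite !tnth_mktuple raddf_sum /=.
under eq_bigr do rewrite mxE scaler_suml.
rewrite exchange_big /=; apply: eq_bigr => k _.
rewrite comp_mpolyZ comp_mpolyXU -tnth_nth tnth_mktuple scaler_sumr.
by apply: eq_bigr => j _; rewrite scalerA.
Qed.

Lemma linear_forms_diag (a : 'rV[C]_3) i :
  tnth (linear_forms (diag_mx a)) i = a 0 i *: 'X_i.
Proof.
rewrite tnth_mktuple (bigD1 i) //= mxE eqxx mulr1n big1 ?addr0 // => j /negPf ji.
by rewrite mxE eq_sym ji scale0r.
Qed.

Definition monomial_value (a : 'rV[C]_3) (m : 'X_{1..3}) := \prod_i a 0 i ^+ m i.

Lemma subst_diagE a f (m : 'X_{1..3}) :
  (subst_form (diag_mx a) f : {mpoly C[3]})@_m = monomial_value a m * (f : {mpoly C[3]})@_m.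
Proof.
rewrite /= {2}(mpolyE f) comp_mpolyE !raddf_sum /= mulr_sumr.
apply: eq_bigr => k _.
rewrite (eq_bigr (fun i => (a 0 i ^+ k i)%:MP * 'X_i ^+ k i)); last first.
  by move=> i _; rewrite linear_forms_diag exprZn mul_mpolyC.
rewrite big_split /= -rmorph_prod /= -mpolyXE_id mul_mpolyC !mcoeffZ mcoeffX.
rewrite mulrCA; have [->//|_] := eqVneq k m.
by rewrite !mulr0.
Qed.

Lemma subst_form1 f : subst_form 1%:M f = f.
Proof.
apply: val_inj; apply/mpolyP => m; rewrite /= -diag_const_mx.
rewrite -[LHS]/((subst_form (diag_mx (const_mx 1)) f : {mpoly C[3]})@_m) subst_diagE.
by rewrite /monomial_value big1 ?mul1r // => i _; rewrite mxE expr1n.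
Qed.

End Substitution.

(** * Limits of forms *)

Section FormLimits.
Variables (T : pointedType) (C : numClosedFieldType).
Variable (G : set ((T -> C) * C)).
Hypothesis maxG : maximal_graph G.

Notation lim := (lim G).
Notation bounded := (bounded G).
Notation ae := (ae G).

Definition lim_mpoly (F : T -> {mpoly C[3]}) (p : {mpoly C[3]}) :=
  forall m, lim (fun x => (F x)@_m) p@_m.

Lemma lim_mpolyM F H p q :
  lim_mpoly F p -> lim_mpoly H q -> lim_mpoly (fun x => F x * H x) (p * q).
Proof.
move=> Fp Hq m; rewrite mcoeffM; under eq_fun do rewrite mcoeffM.
by apply: (lim_sum maxG) => k _; apply: (limM maxG).
Qed.

Lemma lim_mpolyX F p k : lim_mpoly F p -> lim_mpoly (fun x => F x ^+ k) (p ^+ k).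
Proof.
move=> Fp; elim: k => [|k IH].
  under eq_fun do rewrite expr0; rewrite expr0 => m; exact: (lim_const maxG).
rewrite exprS; under eq_fun do rewrite exprS; exact: lim_mpolyM.
Qed.

Lemma lim_mpolyZ c a F p :
  lim c a -> lim_mpoly F p -> lim_mpoly (fun x => c x *: F x) (a *: p).
Proof.
move=> ca Fp m; rewrite mcoeffZ; under eq_fun do rewrite mcoeffZ.
exact: (limM maxG).
Qed.

Lemma lim_mpoly_sum (I : finType) (F : I -> T -> {mpoly C[3]}) p :
  (forall i, lim_mpoly (F i) (p i)) ->
  lim_mpoly (fun x => \sum_i F i x) (\sum_i p i).
Proof.
move=> Fp m; rewrite raddf_sum /=; under eq_fun do rewrite raddf_sum /=.
by apply: (lim_sum maxG) => i _; apply: Fp.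
Qed.

Lemma lim_mpoly_prod (I : finType) (F : I -> T -> {mpoly C[3]}) p :
  (forall i, lim_mpoly (F i) (p i)) ->
  lim_mpoly (fun x => \prod_i F i x) (\prod_i p i).
Proof.
move=> Fp; elim: (index_enum I) => [|i s IH].
  rewrite big_nil; under eq_fun do rewrite big_nil.
  by move=> m; exact: (lim_const maxG).
rewrite big_cons; under eq_fun do rewrite big_cons.
exact: lim_mpolyM.
Qed.

Variable d : nat.
Notation form := (ternary_form C d).

Lemma form_msize (f : form) : (msize (f : {mpoly C[3]}) <= d.+1)%N.
Proof.
rewrite msizeE; apply/bigmax_leqP_seq => m mf _.
by rewrite (dhomog_mf (dhomog_is_dhomog f) mf).
Qed.

Lemma form_coeff_scalar m : scalar (fun f : form => (f : {mpoly C[3]})@_m).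
Proof. by move=> c f g; rewrite /= mcoeffD mcoeffZ. Qed.

Definition monomial_form (m : 'X_{1..3}) : form := @indhomog 3 C d 'X_[m].

(** The index m runs over all degrees at most d; the coefficients vanish in degrees
    other than d, where [monomial_form] takes a default value. *)
Lemma form_monomials (f : form) :
  f = \sum_(m : 'X_{1..3 < d.+1}) (f : {mpoly C[3]})@_m *: monomial_form m.
Proof.
apply: val_inj => /=; rewrite {1}(mpolywE (form_msize f)) raddf_sum /=.
apply: eq_bigr => m _; rewrite /monomial_form /indhomog.
have [md|md] := eqVneq (mdeg m) d.
  by rewrite val_insubd dhomogX /= md eqxx.
by rewrite (dhomog_nemf_coeff (dhomog_is_dhomog f) md) !scale0r.
Qed.

Lemma lim_form_coeff (F : T -> form) f : lim_vec G F f ->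
  lim_mpoly (fun x => F x) f.
Proof. by move=> Ff m; exact: (lim_scalar maxG (form_coeff_scalar m)). Qed.

Lemma lim_coeff_form (F : T -> form) (f : form) : lim_mpoly (fun x => F x) f ->
  lim_vec G F f.
Proof.
move=> Ff i; rewrite (form_monomials f) linear_sum /=.
under eq_fun => x do rewrite (form_monomials (F x)) linear_sum.
apply: (lim_sum maxG) => m _; rewrite linearZ; under eq_fun do rewrite linearZ.
by apply: (limM maxG) => //; exact: (lim_const maxG).
Qed.

Lemma bounded_coeff_lim (F : T -> form) :
  (forall m, bounded (fun x => (F x : {mpoly C[3]})@_m)) -> exists f, lim_vec G F f.
Proof.
move=> bF; pose f : form := \sum_(m : 'X_{1..3 < d.+1}) projT1 (cid (bF m)) *: monomial_form m.
exists f => i; rewrite linear_sum.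
under eq_fun => x do rewrite (form_monomials (F x)) linear_sum.
apply: (lim_sum maxG) => m _; rewrite linearZ; under eq_fun do rewrite linearZ.
apply: (limM maxG); last exact: (lim_const maxG).
by case: (cid _).
Qed.

Lemma lim_subst (F : T -> form) (H : T -> 'M[C]_3) f A :
  lim_vec G F f -> lim_mx G H A ->
  lim_vec G (fun x => subst_form (H x) (F x)) (subst_form A f).
Proof.
move=> /lim_form_coeff Ff HA; apply: lim_coeff_form => /= m.
rewrite (comp_mpolywE _ (form_msize f)).
under eq_fun do rewrite (comp_mpolywE _ (form_msize _)).
move: m; apply: lim_mpoly_sum => k; apply: lim_mpolyZ; first exact: Ff.
apply: lim_mpoly_prod => i; apply: lim_mpolyX; rewrite tnth_mktuple.
under eq_fun do rewrite tnth_mktuple.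
apply: lim_mpoly_sum => j; apply: lim_mpolyZ; first exact: HA.
by move=> m; exact: (lim_const maxG).
Qed.

Lemma lim_vec_const (W : vectType C) (w : W) : lim_vec G (fun=> w) w.
Proof. by move=> i; exact: (lim_const maxG). Qed.

End FormLimits.

(** * Exterior squares *)

Section Wedge.
Variables (C : fieldType) (V : vectType C).
Implicit Types (u v : V).
Notation e := (vbasis {:V}).

(** The universal property of the exterior square, in coordinates. *)
Lemma alternating_expansion (M : lmodType C) (beta : V -> V -> M) u v :
  (forall v, linear (beta^~ v)) -> (forall u, linear (beta u)) ->
  (forall u, beta u u = 0) ->
  beta u v = \sum_ij (wedge u v ij : C) *: beta e`_(val ij).1 e`_(val ij).2.
Proof.
move=> linl linr alt.
have expand (f : V -> M) w : linear f -> f w = \sum_i coord e i w *: f e`_i.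
  move=> lf; have f0 : f 0 = 0.
    by have := lf (-1) 0 0; rewrite scaler0 addr0 scaleN1r addNr.
  rewrite {1}(coord_vbasis (memvf w)).
  elim: (index_enum _) => [|i s IH]; first by rewrite !big_nil.
  by rewrite !big_cons lf IH.
have anti a b : beta b a = - beta a b.
  have addl x y z : beta (x + y) z = beta x z + beta y z.
    by have := linl z 1 x y; rewrite !scale1r.
  have addr x y z : beta z (x + y) = beta z x + beta z y.
    by have := linr z 1 x y; rewrite !scale1r.
  have := alt (a + b); rewrite addl !addr !alt add0r addr0 => /eqP.
  by rewrite addrC addr_eq0 => /eqP.
rewrite (expand (beta^~ v)) //.
under eq_bigr => i _.
  rewrite (expand (beta e`_i)) // scaler_sumr.
  under eq_bigr do rewrite scalerA.
  over.
rewrite pair_bigA /=.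
pose n := \dim {:V}; pose swap (ij : 'I_n * 'I_n) := (ij.2, ij.1).
have swapK : involutive swap by case.
rewrite (bigID (fun ij : 'I_n * 'I_n => ij.1 < ij.2)%N) /=.
rewrite [X in _ + X](bigID (fun ij : 'I_n * 'I_n => ij.2 < ij.1)%N) /=.
rewrite [X in _ + (_ + X)]big1 ?addr0; last first.
  move=> [i j] /=; rewrite -!leqNgt => /andP[ji ij].
  have -> : i = j by apply: val_inj; apply/eqP; rewrite eqn_leq ij ji.
  by rewrite alt scaler0.
rewrite [X in _ + X](reindex_inj (inv_inj swapK)) /=.
rewrite [X in _ + X](eq_bigl (fun ij : 'I_n * 'I_n => ij.1 < ij.2)%N); last first.
  by move=> [i j] /=; case: ltngtP.
rewrite -big_split /= (reindex_omap (val : pair_index n -> _) insub); last first.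
  by move=> ij lt_ij; rewrite insubT.
apply: eq_big => [[ij lt_ij]|[[i j] lt_ij] _] /=.
  by rewrite insubT lt_ij eqxx.
rewrite ffunE /= (anti e`_i) scalerN -scalerBl; congr (_ *: _).
Qed.

End Wedge.

Section WedgeMap.
Variables (C : fieldType) (V : vectType C).
Implicit Types (u v : V).
Notation e := (vbasis {:V}).

Lemma wedge_linearl v : linear (@wedge _ V ^~ v).
Proof.
move=> c u1 u2; apply/ffunP => ij; rewrite !ffunE !linearP /=.
by rewrite /GRing.scale /=; ring.
Qed.

Lemma wedge_linearr u : linear (wedge u).
Proof.
move=> c u1 u2; apply/ffunP => ij; rewrite !ffunE !linearP /=.
by rewrite /GRing.scale /=; ring.
Qed.

Lemma wedgexx u : wedge u u = 0.
Proof. by apply/ffunP => ij; rewrite !ffunE mulrC subrr. Qed.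

Lemma ext2_map_wedge (phi : V -> V) u v : linear phi ->
  ext2_map phi (wedge u v) = wedge (phi u) (phi v).
Proof.
move=> lphi; symmetry.
apply: (@alternating_expansion _ _ _ (fun u v => wedge (phi u) (phi v))).
- by move=> w c u1 u2; rewrite lphi wedge_linearl.
- by move=> w c u1 u2; rewrite lphi wedge_linearr.
- by move=> w; rewrite wedgexx.
Qed.

Lemma wedge_coord_eq0 u v : wedge u v = 0 ->
  forall i j, coord e i u * coord e j v = coord e j u * coord e i v.
Proof.
move=> uv0 i j; wlog ij : i j / (i < j)%N => [wl|].
  by have [/wl//|/wl //|/val_inj ->] := ltngtP i j.
have /ffunP /(_ (exist _ (i, j) ij)) := uv0.
by rewrite !ffunE /= => /eqP; rewrite subr_eq0 => /eqP.
Qed.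

Lemma wedge_eq0 u v : wedge u v = 0 -> u <> 0 -> exists c, v = c *: u.
Proof.
move=> /wedge_coord_eq0 uv u0.
have [i ui|noi] := pickP (fun i => coord e i u != 0); last first.
  case: u0; rewrite (coord_vbasis (memvf u)) big1 // => i _.
  by have /negbFE /eqP -> := noi i; rewrite scale0r.
exists (coord e i v / coord e i u).
rewrite [LHS](coord_vbasis (memvf v)) [in X in _ *: X](coord_vbasis (memvf u)) scaler_sumr.
apply: eq_bigr => j _; rewrite scalerA; congr (_ *: _).
by apply: (mulfI ui); rewrite uv; field.
Qed.

End WedgeMap.

(** * Degenerations in the diagonal torus *)

Section Torus.
Variables (T : pointedType) (C : numClosedFieldType).
Variable (G : set ((T -> C) * C)).
Hypothesis maxG : maximal_graph G.

Notation lim := (lim G).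
Notation bounded := (bounded G).
Notation ae := (ae G).

Lemma limXz f b (n : int) : b != 0 -> lim f b -> lim (fun x => f x ^ n) (b ^ n).
Proof.
move=> b0 fb; case: n => n; first exact: (limX maxG).
by apply: (limV maxG); [rewrite expf_neq0|exact: (limX maxG)].
Qed.

Lemma bounded_of_power f (D : int) b : D != 0 -> b != 0 ->
  lim (fun x => f x ^ D) b -> bounded f.
Proof.
move=> D0 b0 fDb; have [//|pole] := bounded_or_pole maxG f.
case: D D0 fDb => n n0 fDb; exfalso.
- have := limX maxG n pole; rewrite expr0n (_ : n == 0 = false); last exact/negbTE.
  under eq_fun do rewrite exprVn.
  move=> /(lim_uniq maxG (limV maxG b0 fDb)) /eqP.
  by rewrite invr_eq0 (negPf b0).
- have := limX maxG n.+1 pole; rewrite expr0n /=.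
  under eq_fun do rewrite exprVn.
  by move=> /(lim_uniq maxG fDb) /eqP; rewrite (negPf b0).
Qed.

(** Cramer's rule for the exponents p, q and (1, 1, 1): a combination of these
    three vectors is a multiple of the first basis vector, the multiplier being
    the determinant. *)
Lemma monomial_elimination (x y z : C) (p0 p1 p2 q0 q1 q2 : int) :
  x * y * z = 1 ->
  (x ^ p0 * y ^ p1 * z ^ p2) ^ (q1 - q2) * (x ^ q0 * y ^ q1 * z ^ q2) ^ (p2 - p1)
  = x ^ ((q1 - q2) * p0 + (q2 - q0) * p1 + (q0 - q1) * p2).
Proof.
move=> xyz.
have [x0 y0 z0] : [/\ x != 0, y != 0 & z != 0].
  have : x * y * z != 0 by rewrite xyz oner_eq0.
  by rewrite !mulf_eq0 !negb_or -andbA => /and3P.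
rewrite !expfzMl !exprz_exp.
transitivity (x ^ (p0 * (q1 - q2) + q0 * (p2 - p1)) * y ^ (p1 * (q1 - q2) + q1 * (p2 - p1)) *
  z ^ (p2 * (q1 - q2) + q2 * (p2 - p1))).
  by rewrite !expfzDr //; ring.
(* This is the coefficient of (1, 1, 1) in Cramer's rule. *)
pose ex := p1 * q2 - p2 * q1.
have -> : p1 * (q1 - q2) + q1 * (p2 - p1) = - ex by rewrite /ex; ring.
have -> : p2 * (q1 - q2) + q2 * (p2 - p1) = - ex by rewrite /ex; ring.
have -> : p0 * (q1 - q2) + q0 * (p2 - p1) =
  ((q1 - q2) * p0 + (q2 - q0) * p1 + (q0 - q1) * p2) - ex by rewrite /ex; ring.
by rewrite expfzDr // -!mulrA -expfzMl -expfzMl mulrA xyz exp1rz mulr1.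
Qed.

Variable a : T -> 'rV[C]_3.
Hypothesis prod_a : ae (fun x => \prod_i a x 0 i = 1).

Lemma monomial_value3 x m : monomial_value (a x) m =
  a x 0 0 ^ (m 0 : int) * a x 0 1 ^ (m 1 : int) * a x 0 2 ^ (m 2 : int).
Proof.
rewrite /monomial_value !big_ord_recl big_ord0 mulr1 mulrA.
by congr (_ * _ * _); congr (a x 0 _ ^+ m _); exact: val_inj.
Qed.

(** The cross product of q with (1, 1, 1), with indices read modulo 3. *)
Definition cross (q : 'X_{1..3}) (i : 'I_3) : int := (q (i + 1))%:Z - (q (i + 2))%:Z.

(** The exponents of weight zero and (1, 1, 1) span a lattice.  If its rank is 3,
    a multiple of each basis vector has weight zero, so that each a_i has
    weight zero too, the value group being torsion free.  If not, an integral
    vector is orthogonal to the lattice. *)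
Lemma torus_dichotomy (M : 'X_{1..3} -> Prop) :
  (forall m, M m -> exists2 b, b != 0 & lim (fun x => monomial_value (a x) m) b) ->
  (forall i, bounded (fun x => a x 0 i)) \/
  exists b : 'I_3 -> int, [/\ exists i, b i != 0, \sum_i b i = 0 &
     forall m, M m -> \sum_i b i * (m i)%:Z = 0].
Proof.
move=> unitM.
have sum3 (F : 'I_3 -> int) : \sum_i F i = F 0 + F 1 + F 2.
  rewrite !big_ord_recl big_ord0 addr0 addrA.
  by congr (F _ + F _ + F _); exact: val_inj.
(* If all exponents are multiples of (1, 1, 1), then (1, -1, 0) is orthogonal to
   them; otherwise the candidate is a cross product. *)
have [bal|/existsNP[q /not_implyP[Mq nbal]]] :=
  pselect (forall m, M m -> m 0 = m 1 /\ m 1 = m 2).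
  right; exists (fun i => if i == 0 then 1 else if i == 1 then -1 else 0); split.
  - by exists 0.
  - by rewrite sum3.
  - by move=> m /bal[m01 m12]; rewrite sum3 /= m01; ring.
have [bal|/existsNP[p /not_implyP[Mp /eqP D0]]] :=
  pselect (forall m, M m -> \sum_i cross q i * (m i)%:Z = 0).
  right; exists (cross q); split => //.
  - apply: contrapT => nb; apply: nbal.
    have z i : cross q i = 0 by apply/eqP/negP => /negP ?; apply: nb; exists i.
    have := z 0; have := z 1; rewrite /cross => /eqP + /eqP.
    rewrite !subr_eq0 !eqz_nat => /eqP + /eqP.
    have -> : 0 + 1 = 1 :> 'I_3 by exact: val_inj.
    have -> : 0 + 2 = 2 :> 'I_3 by exact: val_inj.
    have -> : 1 + 1 = 2 :> 'I_3 by exact: val_inj.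
    have -> : 1 + 2 = 0 :> 'I_3 by exact: val_inj.
    by move=> <- ->.
  - rewrite sum3 /cross.
    have -> : 0 + 1 = 1 :> 'I_3 by exact: val_inj.
    have -> : 0 + 2 = 2 :> 'I_3 by exact: val_inj.
    have -> : 1 + 1 = 2 :> 'I_3 by exact: val_inj.
    have -> : 1 + 2 = 0 :> 'I_3 by exact: val_inj.
    have -> : 2 + 1 = 0 :> 'I_3 by exact: val_inj.
    have -> : 2 + 2 = 1 :> 'I_3 by exact: val_inj.
    by ring.
left.
have [bp bp0 limp] := unitM _ Mp; have [bq bq0 limq] := unitM _ Mq.
move: D0; rewrite sum3 /cross.
have -> : 0 + 1 = 1 :> 'I_3 by exact: val_inj.
have -> : 0 + 2 = 2 :> 'I_3 by exact: val_inj.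
have -> : 1 + 1 = 2 :> 'I_3 by exact: val_inj.
have -> : 1 + 2 = 0 :> 'I_3 by exact: val_inj.
have -> : 2 + 1 = 0 :> 'I_3 by exact: val_inj.
have -> : 2 + 2 = 1 :> 'I_3 by exact: val_inj.
set D := (X in X != 0) => D0.
have prod3 x : \prod_i a x 0 i = 1 -> a x 0 0 * a x 0 1 * a x 0 2 = 1.
  rewrite !big_ord_recl big_ord0 mulr1 mulrA => <-.
  by congr (a x 0 _ * a x 0 _ * a x 0 _); exact: val_inj.
have key (s t : int) i : (forall x, \prod_i a x 0 i = 1 ->
    monomial_value (a x) p ^ s * monomial_value (a x) q ^ t = a x 0 i ^ D) ->
    bounded (fun x => a x 0 i).
  move=> e; apply: (bounded_of_power D0 (b := bp ^ s * bq ^ t)).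
    by rewrite mulf_neq0 // expfz_neq0.
  apply: (lim_ae maxG prod_a e); exact: (limM maxG) (limXz s bp0 limp) (limXz t bq0 limq).
move=> i; have : i \in [:: 0; 1; 2] by case: i => [[|[|[|?]]]].
rewrite !inE => /or3P[]/eqP->.
- apply: (key ((q 1)%:Z - (q 2)%:Z) ((p 2)%:Z - (p 1)%:Z)) => x /prod3 ax.
  by rewrite !monomial_value3 monomial_elimination.
- apply: (key ((q 2)%:Z - (q 0)%:Z) ((p 0)%:Z - (p 2)%:Z)) => x /prod3 ax.
  have rot (u v w : C) : u * v * w = v * w * u by ring.
  rewrite !monomial_value3 !(rot (a x 0 0 ^ _)) monomial_elimination; last by rewrite -rot.
  by congr (_ ^ _); rewrite /D; ring.
- apply: (key ((q 0)%:Z - (q 1)%:Z) ((p 1)%:Z - (p 0)%:Z)) => x /prod3 ax.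
  have rot (u v w : C) : u * v * w = w * u * v by ring.
  rewrite !monomial_value3 !(rot (a x 0 0 ^ _)) monomial_elimination; last by rewrite -rot.
  by congr (_ ^ _); rewrite /D; ring.
Qed.
End Torus.

(** * The action of SL3 on ternary forms *)

Section Action.
Variables (C : fieldType) (d : nat).
Notation form := (ternary_form C d).
Notation act := (@ternary_form_act C d).

Lemma actE g f : act g f = subst_form (invmx g) f.
Proof. by []. Qed.

Lemma act_invmx g f : act (invmx g) f = subst_form g f.
Proof. by rewrite actE invmxK. Qed.

Lemma SL3_unit (g : 'M[C]_3) : SL3 g -> g \in unitmx.
Proof. by rewrite /SL3 /= unitmxE => ->; exact: unitr1. Qed.

Lemma SL3_inv (g : 'M[C]_3) : SL3 g -> SL3 (invmx g).
Proof. by rewrite /SL3 /= det_inv => ->; exact: invr1. Qed.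

Lemma SL3_mul (g h : 'M[C]_3) : SL3 g -> SL3 h -> SL3 (g *m h).
Proof. by rewrite /SL3 /= det_mulmx => -> ->; rewrite mulr1. Qed.

Lemma actM g h f : g \in unitmx -> h \in unitmx ->
  act (g *m h) f = act g (act h f).
Proof.
move=> ug uh; rewrite !actE -subst_formM; congr subst_form.
have ugh : g *m h \in unitmx by rewrite unitmx_mul ug.
by apply: (can_inj (mulmxK ugh)); rewrite mulVmx // mulmxA mulmxKV // mulVmx.
Qed.

Lemma act1 f : act 1%:M f = f.
Proof. by rewrite actE invmx1 subst_form1. Qed.

Lemma act_linear g : linear (act g).
Proof. exact: subst_form_linear. Qed.

End Action.

(** * Stability of curves under torus degenerations *)

Section StabilityCriteria.
Variables (C : numClosedFieldType) (d : nat).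
Notation form := (ternary_form C d).
Notation act := (@ternary_form_act C d).

(** The points of a one-parameter subgroup at the parameters 2^n, enough of them
    to be infinitely many. *)
Definition one_parameter (b : 'I_3 -> int) (n : nat) : 'M[C]_3 :=
  diag_mx (\row_i (2 ^ (b i * n%:Z))).

Lemma one_parameter_SL3 b n : \sum_i b i = 0 -> SL3 (one_parameter b n).
Proof.
move=> b0; rewrite /SL3 /= det_diag; under eq_bigr do rewrite mxE.
have two0 : 2 != 0 :> C by rewrite pnatr_eq0.
transitivity (2 ^ ((\sum_i b i) * n%:Z) : C); last by rewrite b0 mul0r.
rewrite mulr_suml; elim/big_rec2: _ => // i x y _ ->.
by rewrite expfzDr.
Qed.

Lemma one_parameter_inj b i : b i != 0 -> injective (one_parameter b).
Proof.
have two0 : 2 != 0 :> C by rewrite pnatr_eq0.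
have expz2_eq1 (k : int) : (2 : C) ^ k = 1 -> k = 0.
  have nat_case n : (2 : C) ^+ n = 1 -> n = 0.
    by rewrite -natrX => /eqP; rewrite (eqr_nat C _ 1) -(expn0 2) eqn_exp2l // => /eqP.
  case: k => n; first by move=> /nat_case ->.
  by move=> /(congr1 GRing.inv); rewrite invrK invr1 => /nat_case.
move=> bi m n /matrixP /(_ i i); rewrite !mxE eqxx !mulr1n => e.
have : (2 : C) ^ (b i * m%:Z - b i * n%:Z) = 1.
  by rewrite expfzDr // -invr_expz e divff // expfz_neq0.
move=> /expz2_eq1 /eqP; rewrite subr_eq0 => /eqP /(mulfI bi).
by case.
Qed.

Lemma one_parameter_fixes b n (f : form) :
  (forall m, (f : {mpoly C[3]})@_m != 0 -> \sum_i b i * (m i)%:Z = 0) ->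
  subst_form (one_parameter b n) f = f.
Proof.
move=> hb; apply: val_inj; apply/mpolyP => m.
rewrite [LHS]subst_diagE; have [->|fm] := eqVneq ((f : {mpoly C[3]})@_m) 0.
  exact: mulr0.
have two0 : 2 != 0 :> C by rewrite pnatr_eq0.
suff -> : monomial_value (\row_i ((2 : C) ^ (b i * n%:Z))) m = 1 by rewrite mul1r.
transitivity ((2 : C) ^ ((\sum_i b i * (m i)%:Z) * n%:Z)); last by rewrite hb // mul0r.
rewrite /monomial_value mulr_suml; elim/big_rec2: _ => // i x y _ ->.
by rewrite mxE exprnP exprz_exp expfzDr // mulrAC.
Qed.


Lemma one_parameter_stabilizer (b : 'I_3 -> int) (f : form) :
  (exists i, b i != 0) -> \sum_i b i = 0 ->
  (forall m, (f : {mpoly C[3]})@_m != 0 -> \sum_i b i * (m i)%:Z = 0) ->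
  ~ finite_set (SL3_stabilizer act f).
Proof.
move=> [i bi] sumb fb finf; apply: infinite_nat.
have -> : [set: nat] = (fun n => invmx (one_parameter b n)) @^-1` SL3_stabilizer act f.
  apply/seteqP; split => // n _; split.
    by apply: SL3_inv; exact: one_parameter_SL3.
  by rewrite act_invmx one_parameter_fixes.
apply: finite_preimage finf => m n _ _ /(congr1 invmx); rewrite !invmxK.
exact: one_parameter_inj bi _ _.
Qed.

Lemma finite_stabilizer_orbit (f : form) g : SL3 g ->
  finite_set (SL3_stabilizer act f) -> finite_set (SL3_stabilizer act (act g f)).
Proof.
move=> sg finf; have ug := SL3_unit sg.
pose conj (h : 'M[C]_3) := invmx g *m h *m g.
apply: (sub_finite_set (B := conj @^-1` SL3_stabilizer act f)).
  move=> h [sh hf]; split.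
    by apply: SL3_mul => //; apply: SL3_mul => //; exact: SL3_inv.
  rewrite actM ?unitmx_mul ?unitmx_inv ?ug ?(SL3_unit sh) //.
  rewrite actM ?unitmx_inv ?(SL3_unit sh) // hf -actM ?unitmx_inv //.
  by rewrite mulVmx // act1.
apply: finite_preimage finf => h k _ _ /(congr1 (fun M => g *m M *m invmx g)).
by rewrite /conj !mulmxA mulmxV // !mul1mx !mulmxK.
Qed.

Variables (T : pointedType) (G : set ((T -> C) * C)).
Hypothesis maxG : maximal_graph G.

Lemma torus_orbit (w : form) (k : 'M[C]_3) (a : 'rV[C]_3) :
  \det k = 1 -> \prod_i a 0 i = 1 ->
  SL3_orbit act w (subst_form (diag_mx a) (subst_form k w)).
Proof.
move=> dk pa; exists (invmx (k *m diag_mx a)); last by rewrite act_invmx subst_formM.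
by apply: SL3_inv; rewrite /SL3 /= det_mulmx dk mul1r det_diag.
Qed.

Lemma line_coeff (f w : form) (k : 'M[C]_3) m : <[f]>%VS = <[w]>%VS ->
  (subst_form k w : {mpoly C[3]})@_m != 0 -> (subst_form k f : {mpoly C[3]})@_m != 0.
Proof.
move=> fw; have /vlineP[c ->] : w \in <[f]>%VS by rewrite fw memv_line.
have -> : subst_form k (c *: f) = c *: subst_form k f.
  by apply: val_inj; rewrite /= comp_mpolyZ.
by rewrite /= mcoeffZ mulf_eq0 negb_or => /andP[].
Qed.

(** Otherwise 0 would be in the closure of the orbit. *)
Lemma semistable_not_contracted (f : form) (k : 'M[C]_3) (a : T -> 'rV[C]_3) :
  semistable act <[f]> -> \det k = 1 -> ae G (fun x => \prod_i a x 0 i = 1) ->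
  ~ (forall m, (subst_form k f : {mpoly C[3]})@_m != 0 ->
       lim G (fun x => monomial_value (a x) m) 0).
Proof.
move=> [w [w0 fw] nw] dk pa contr; apply: nw.
apply: (lim_vec_closure maxG (F := fun x => subst_form (diag_mx (a x)) (subst_form k w))).
  by apply: (ae_mono maxG _ pa) => x; exact: torus_orbit.
apply: (lim_coeff_form maxG) => m; rewrite mcoeff0.
under eq_fun do rewrite subst_diagE.
have [->|/(line_coeff fw) /contr mv0] := eqVneq ((subst_form k w : {mpoly C[3]})@_m) 0.
  by under eq_fun do rewrite mulr0; exact: (lim_const maxG).
by rewrite -(mul0r (subst_form k w)@_m); apply: (limM maxG) => //; exact: (lim_const maxG).
Qed.

(** The limit v of the degeneration is in the orbit, which is closed.  The
    monomials of v have weight zero; if a is not bounded, [torus_dichotomy] gives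
    a one-parameter subgroup in the stabilizer of v, which is conjugate to the
    finite stabilizer of the form. *)
Lemma stable_torus_bounded (f : form) (k : 'M[C]_3) (a : T -> 'rV[C]_3) :
  stable act <[f]> -> \det k = 1 -> ae G (fun x => \prod_i a x 0 i = 1) ->
  (forall m, (subst_form k f : {mpoly C[3]})@_m != 0 ->
     bounded G (fun x => monomial_value (a x) m)) ->
  forall i, bounded G (fun x => a x 0 i).
Proof.
move=> [w [w0 fw] [clw finw]] dk pa bnd.
have [v Fv] : exists v, lim_vec G (fun x => subst_form (diag_mx (a x)) (subst_form k w)) v.
  apply: (bounded_coeff_lim maxG) => m; under eq_fun do rewrite subst_diagE.
  have [->|/(line_coeff fw) /bnd [b mvb]] := eqVneq ((subst_form k w : {mpoly C[3]})@_m) 0.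
    by under eq_fun do rewrite mulr0; exact: bounded0.
  by apply: (boundedM maxG); [exists b | exists (subst_form k w)@_m; exact: (lim_const maxG)].
have [g sg gv] : SL3_orbit act w v.
  rewrite -clw; apply: (lim_vec_closure maxG _ Fv).
  by apply: (ae_mono maxG _ pa) => x; exact: torus_orbit.
have unitM m : (v : {mpoly C[3]})@_m != 0 ->
    exists2 b, b != 0 & lim G (fun x => monomial_value (a x) m) b.
  move=> vm; have := lim_form_coeff maxG Fv m.
  under eq_fun do rewrite subst_diagE.
  set c := (subst_form k w)@_m => limc.
  have c0 : c != 0.
    apply: contra_neq vm => c0; apply: (lim_uniq maxG limc).
    by under eq_fun do rewrite c0 mulr0; exact: (lim_const maxG).
  exists ((v : {mpoly C[3]})@_m / c); first by rewrite mulf_neq0 // invr_eq0.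
  apply: lim_ext (limM maxG limc (lim_const maxG c^-1)) => x.
  by rewrite mulfK.
have [//|[b [b0 sumb vb]]] := torus_dichotomy maxG pa unitM.
case: (one_parameter_stabilizer b0 sumb vb).
rewrite -gv; exact: finite_stabilizer_orbit.
Qed.

End StabilityCriteria.

(** * Properness of the orbit map of a pencil *)

Section PencilProper.
Variables (C : numClosedFieldType) (d : nat).
Notation form := (ternary_form C d).
Notation act := (@ternary_form_act C d).
Notation coeff m f := ((f : {mpoly C[3]})@_m).
Variables (u v : form).

Hypothesis indep : forall b c, b *: u + c *: v = 0 -> b = 0 /\ c = 0.
Hypothesis members : forall b c (f : form), f = b *: u + c *: v -> f != 0 ->
  stable act <[f]> \/ strictly_semistable act <[f]>.
Hypothesis at_most_one : strictly_semistable act <[u]> ->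
  strictly_semistable act <[v]> -> <[u]>%VS = <[v]>%VS.

Variables (T : pointedType) (G : set ((T -> C) * C)).
Hypothesis maxG : maximal_graph G.

Notation lim := (lim G).
Notation bounded := (bounded G).
Notation ae := (ae G).

Definition minor (m m' : 'X_{1..3}) (f g : form) : C :=
  coeff m f * coeff m' g - coeff m' f * coeff m g.

Lemma minor_linearl m m' g : scalar (minor m m' ^~ g).
Proof.
move=> c f1 f2; rewrite /minor /= !mcoeffD !mcoeffZ; ring.
Qed.

Lemma minor_linearr m m' f : scalar (minor m m' f).
Proof.
move=> c f1 f2; rewrite /minor /= !mcoeffD !mcoeffZ; ring.
Qed.

Lemma minor_diag m m' (a : 'rV[C]_3) f g :
  minor m m' (subst_form (diag_mx a) f) (subst_form (diag_mx a) g) =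
  monomial_value a m * monomial_value a m' * minor m m' f g.
Proof. by rewrite /minor !subst_diagE; ring. Qed.

Lemma lim_minor m m' (F H : T -> form) f g : lim_vec G F f -> lim_vec G H g ->
  lim (fun x => minor m m' (F x) (H x)) (minor m m' f g).
Proof.
move=> /(lim_form_coeff maxG) Ff /(lim_form_coeff maxG) Hg.
by apply: (limB maxG); apply: (limM maxG).
Qed.

Lemma ext2_entry_scalar (V : vectType C) ij : scalar (fun w : ext2 V => w ij).
Proof. by move=> c w w'; rewrite !ffunE. Qed.

(** Only the diagonal part a of the Smith form has to be bounded, the other factors
    being bounded together with their inverses.  As long as a is not, no form
    all of whose weights are nonnegative can be stable. *)
Lemma pencil_proper (h : T -> 'M[C]_3) :
  ae (fun x => \det (h x) = 1) ->
  (exists y, lim_vec G (fun x => wedge (subst_form (h x) u) (subst_form (h x) v)) y) ->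
  bounded_mx G h.
Proof.
move=> det_h [y wedge_y].
have [K [N [a [detK bK uN hNa]]]] := smith_SL maxG det_h.
have [k limK] := bounded_mx_lim bK.
have detk : \det k = 1.
  by have := lim_det maxG limK; under eq_fun do rewrite detK;
     move=> /(lim_uniq maxG (lim_const maxG 1)).
have prod_a : ae (fun x => \prod_i a x 0 i = 1) by apply: (ae_mono maxG _ hNa) => x [].
suff bounded_a : forall i, bounded (fun x => a x 0 i).
  have bdiag : bounded_mx G (fun x => diag_mx (a x)).
    move=> i j; under eq_fun do rewrite mxE.
    case: (i == j); first by under eq_fun do rewrite mulr1n.
    by under eq_fun do rewrite mulr0n; exact: bounded0.
  have [unitN bN iN] := uN.
  apply: (bounded_mx_ae maxG hNa (F := fun x => K x *m diag_mx (a x) *m invmx (N x))).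
    by move=> x [<- _]; rewrite mulmxK.
  by apply: (bounded_mulmx maxG) => //; exact: (bounded_mulmx maxG).
pose mv m x := monomial_value (a x) m.
pose U x := subst_form (K x) u; pose V x := subst_form (K x) v.
pose u' := subst_form k u; pose v' := subst_form k v.
have limUu : lim_vec G U u' by apply: (lim_subst maxG) => //; exact: (lim_vec_const maxG).
have limVv : lim_vec G V v' by apply: (lim_subst maxG) => //; exact: (lim_vec_const maxG).
(* Composition with the bounded factor N is absorbed by the expansion of the
   minors on the coordinates of the wedge product. *)
have minor_bounded m m' : bounded (fun x => mv m x * mv m' x * minor m m' (U x) (V x)).
  pose beta x (f g : form) : C^o := minor m m' (subst_form (N x) f) (subst_form (N x) g).
  have : bounded (fun x => beta x (subst_form (h x) u) (subst_form (h x) v)).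
    have [n limN] := bounded_mx_lim (unimodular_bounded uN).
    have expand x f g : beta x f g = \sum_ij (wedge f g ij : C) *
        beta x (vbasis {:form})`_(val ij).1 (vbasis {:form})`_(val ij).2.
      apply: alternating_expansion.
      - by move=> g' c f1 f2; rewrite /beta subst_form_linear minor_linearl.
      - by move=> f' c f1 f2; rewrite /beta subst_form_linear minor_linearr.
      - by move=> f'; rewrite /beta /minor mulrC subrr.
    under eq_fun do rewrite expand.
    eexists; apply: (lim_sum maxG) => ij _; apply: (limM maxG).
      exact: (lim_scalar maxG (ext2_entry_scalar ij) wedge_y).
    by apply: lim_minor; apply: (lim_subst maxG) limN; exact: (lim_vec_const maxG).
  apply: (bounded_ae maxG hNa) => x [e _].
  have sub (f : form) : subst_form (N x) (subst_form (h x) f) =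
      subst_form (diag_mx (a x)) (subst_form (K x) f) by rewrite -!subst_formM e.
  by rewrite /beta (sub u) (sub v) minor_diag.
have mv_neq0 m : ae (fun x => mv m x != 0).
  apply: (ae_mono maxG _ prod_a) => x ax.
  apply/prodf_neq0 => i _; apply: expf_neq0; apply: contra_eq_neq ax => ai.
  by rewrite (bigD1 i) //= ai mul0r eq_sym oner_eq0.
(* A minor with a nonzero limit is a unit. *)
have pair_bounded m m' : minor m m' u' v' != 0 -> bounded (fun x => mv m x * mv m' x).
  move=> mn0; have limMn := lim_minor m m' limUu limVv.
  apply: (bounded_ae maxG (ae_neq0 maxG mn0 limMn)) (boundedM maxG (minor_bounded m m') (ex_intro _ _ (limV maxG mn0 limMn))).
  by move=> x Mx /=; rewrite mulfK.
have u0 : u != 0.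
  apply/eqP => u0; have [] := @indep 1 0; first by rewrite u0 scaler0 scale0r addr0.
  by move/eqP; rewrite oner_eq0.
have v0 : v != 0.
  apply/eqP => v0; have [] := @indep 0 1; first by rewrite v0 scaler0 scale0r addr0.
  by move=> _ /eqP; rewrite oner_eq0.
have substk (f : form) : subst_form k f = 0 -> f = 0.
  move=> kf; rewrite -(subst_form1 f) -(mulmxV (SL3_unit detk)) subst_formM kf.
  by apply: val_inj; rewrite /= comp_mpoly0.
(* The monomials that occur in the limit pencil, and one of least weight among
   them. *)
pose S := msupp (u' : {mpoly C[3]}) ++ msupp (v' : {mpoly C[3]}).
have inS m : (m \in S) = (coeff m u' != 0) || (coeff m v' != 0).
  by rewrite mem_cat !mcoeff_msupp.
have [|m0 m0S min0] := dvd_min maxG (s := S) mv.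
  apply/eqP => /(congr1 size)/eqP; rewrite size_cat addn_eq0 size_eq0 msupp_eq0 => /andP[/eqP u'0 _].
  by move/eqP: u0; apply; apply: substk; exact: val_inj.
have mv_min m : m \in S -> bounded (fun x => mv m x / mv m0 x) by move=> /min0[].
(* This is the member of the pencil in which the monomial m0 does not occur
   after the substitution. *)
pose g := coeff m0 u' *: v - coeff m0 v' *: u.
have g_coeff m : coeff m (subst_form k g) = minor m0 m u' v'.
  have -> : subst_form k g = coeff m0 u' *: v' - coeff m0 v' *: u'.
    by apply: val_inj; rewrite /= comp_mpolyB !comp_mpolyZ.
  by rewrite /minor /= mcoeffB !mcoeffZ; ring.
have g0 : g != 0.
  apply/eqP => g0; have [] := @indep (- coeff m0 v') (coeff m0 u').
    by rewrite scaleNr addrC.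
  move=> /eqP; rewrite oppr_eq0 => /eqP v'0 u'0.
  by move: m0S; rewrite inS u'0 v'0 eqxx.
have g_bounded m : coeff m (subst_form k g) != 0 -> bounded (mv m).
  rewrite g_coeff => mn0.
  have mS : m \in S.
    rewrite inS; apply: contra_neqT mn0; rewrite negb_or !negbK => /andP[/eqP um /eqP vm].
    by rewrite /minor um vm mulr0 mul0r subrr.
  have b2 : bounded (fun x => mv m x * mv m x).
    apply: (bounded_ae maxG (mv_neq0 m0)) (boundedM maxG (mv_min m mS) (pair_bounded _ _ mn0)).
    by move=> x m0x /=; field.
  have [//|pole] := bounded_or_pole maxG (mv m).
  apply: (bounded_ae maxG (mv_neq0 m)) (boundedM maxG b2 (ex_intro _ _ pole)).
  by move=> x mx /=; rewrite mulfK.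
have g_member : g = (- coeff m0 v') *: u + coeff m0 u' *: v by rewrite /g scaleNr addrC.
(* All weights of g are nonnegative, so that g can only be strictly semistable;
   then one of them is zero, which bounds the weight of m0. *)
have [st|[ss _]] := members g_member g0.
  exact: (stable_torus_bounded maxG st detk prod_a g_bounded).
have [m /not_implyP[gm nlim]] : exists m, ~ (coeff m (subst_form k g) != 0 -> lim (mv m) 0).
  by apply/existsNP; exact: (semistable_not_contracted maxG ss detk prod_a).
have [b limb] := g_bounded m gm.
have b0 : b != 0 by apply: contra_notN nlim => /eqP <-.
have m0_bounded : bounded (mv m0).
  rewrite g_coeff in gm.
  apply: (bounded_ae maxG (mv_neq0 m)) (boundedM maxG (pair_bounded _ _ gm) (ex_intro _ _ (limV maxG b0 limb))).
  by move=> x mx /=; rewrite mulfK.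
have S_bounded m' : m' \in S -> bounded (mv m').
  move=> /mv_min bm; apply: (bounded_ae maxG (mv_neq0 m0)) (boundedM maxG bm m0_bounded).
  by move=> x mx /=; rewrite divfK.
(* Now all weights of the pencil are nonnegative, and neither u nor v can be
   stable. *)
have [st|ssu] := members (f := u) (b := 1) (c := 0) (ltac:(by rewrite scale1r scale0r addr0)) u0.
  apply: (stable_torus_bounded maxG st detk prod_a) => m' um'.
  by apply: S_bounded; rewrite inS um'.
have [st|ssv] := members (f := v) (b := 0) (c := 1) (ltac:(by rewrite scale1r scale0r add0r)) v0.
  apply: (stable_torus_bounded maxG st detk prod_a) => m' vm'.
  by apply: S_bounded; rewrite inS vm' orbT.
have /vlineP[c vc] : v \in <[u]>%VS by rewrite (at_most_one ssu ssv) memv_line.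
have [] := @indep c (-1); first by rewrite scaleN1r vc subrr.
by move=> _ /eqP; rewrite oppr_eq0 oner_eq0.
Qed.

End PencilProper.

(** * From properness to stability *)
(** Such matrices are matrices of indices in one finite list of entries. *)
Lemma finite_matrices (K : zmodType) m n (S : set 'M[K]_(m, n)) :
  (forall i j, finite_set [set x i j | x in S]) -> finite_set S.
Proof.
move=> finS.
have entries ij : exists s : seq K, forall x, S x -> x ij.1 ij.2 \in s.
  have /finite_seqP[s es] := finS ij.1 ij.2; exists s => x Sx.
  by have : [set y ij.1 ij.2 | y in S] (x ij.1 ij.2); [exists x|rewrite es].
pose s := flatten (codom (fun ij => projT1 (cid (entries ij)))).
have in_s x i j : S x -> x i j \in s.
  move=> Sx; apply/flatten_mapP; exists (i, j); first by rewrite mem_enum.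
  by case: (cid _) => l /=; apply.
apply: (sub_finite_set (B := [set` codom (fun k : 'M['I_(size s)]_(m, n) =>
  map_mx (fun i => nth 0 s (val i)) k)])); last exact: finite_seq.
move=> x Sx /=; apply/codomP.
exists (\matrix_(i, j) Ordinal (etrans (index_mem _ _) (in_s x i j Sx))).
by apply/matrixP => i j; rewrite !mxE /= nth_index // in_s.
Qed.

Lemma finite_poly_zeros (C : closedFieldType) (p : {poly C}) : p != 0 ->
  finite_set [set t | p.[t] = 0].
Proof.
move=> p0; have [r pr] := closed_field_poly_normal p.
apply: (sub_finite_set (B := [set` r])); last exact: finite_seq.
move=> t /= /rootP; rewrite pr rootZ ?lead_coef_eq0 //.
by rewrite root_prod_XsubC.
Qed.


(** The group elements themselves index the degenerations; the alias makes their
    type a pointed one, as needed for functions on it to form a nonzero ring. *)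
Definition matrix_space (C : numClosedFieldType) : Type := 'M[C]_3.
HB.instance Definition _ C := Choice.on (matrix_space C).
HB.instance Definition _ C := isPointed.Build (matrix_space C) (0 : 'M[C]_3).

Section PencilStable.
Variables (C : numClosedFieldType) (d : nat).
Notation form := (ternary_form C d).
Notation act := (@ternary_form_act C d).
Variables (u v : form).

Notation w := (wedge u v).

Lemma ext2_act_wedge g : ext2_act act g w = wedge (act g u) (act g v).
Proof. by rewrite /ext2_act ext2_map_wedge //; exact: act_linear. Qed.

Lemma polyfunC (W : vectType C) c (y : W) : polyfun c%:MP y = c.
Proof. exact: mevalC. Qed.
Lemma polyfunD (W : vectType C) p q (y : W) : polyfun (p + q) y = polyfun p y + polyfun q y.
Proof. exact: mevalD. Qed.
Lemma polyfunM (W : vectType C) p q (y : W) : polyfun (p * q) y = polyfun p y * polyfun q y.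
Proof. exact: mevalM. Qed.

(** The matrix h x plays the part of the inverse of the group element, since the
    action substitutes inverses. *)
Definition proper_orbit_map := forall (G : set ((matrix_space C -> C) * C)) h,
  maximal_graph G -> ae G (fun x => \det (h x) = 1) ->
  (exists y, lim_vec G (fun x => wedge (subst_form (h x) u) (subst_form (h x) v)) y) ->
  bounded_mx G h.

Hypothesis proper : proper_orbit_map.

(** The pairs (x |-> p (x w), p y) form a proper algebra because y is in the
    closure, and x w tends to y in any place that contains them. *)
Lemma orbit_closed : zariski_closed (SL3_orbit (ext2_act act) w).
Proof.
apply/seteqP; split => [y cly|y Oy p]; last by apply.
pose G0 : set ((matrix_space C -> C) * C) := fun z => exists p,
  (forall x, SL3 x -> z.1 x = polyfun p (ext2_act act x w)) /\ z.2 = polyfun p y.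
have hG0 : limit_graph G0.
  split.
  - by move=> c; exists c%:MP; split => [x _|]; rewrite polyfunC.
  - move=> z1 z2 [p [p1 p2]] [q [q1 q2]]; exists (p + q).
    by split => [x sx|]; rewrite polyfunD -?p2 -?q2 -?p1 -?q1.
  - move=> z1 z2 [p [p1 p2]] [q [q1 q2]]; exists (p * q).
    by split => [x sx|]; rewrite polyfunM -?p2 -?q2 -?p1 -?q1.
  - move=> [p [/= p1 p2]].
    have py0 : polyfun p y = 0 by apply: cly => _ [x sx <-]; rewrite -p1.
    by move/eqP: p2; rewrite py0 oner_eq0.
have [G maxG G0G] := maximal_graph_exists hG0.
have aeSL : ae G (fun x => SL3 (x : 'M[C]_3)).
  apply: G0G; exists 1; split => [x sx|]; last by rewrite -mpolyC1 polyfunC.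
  by rewrite -mpolyC1 polyfunC /= asboolT.
have lim_y : lim_vec G (fun x => ext2_act act x w) y.
  move=> i; apply: G0G; exists 'X_i.
  by split => [x sx|]; rewrite /polyfun mevalXU.
pose h (x : matrix_space C) := invmx (x : 'M[C]_3).
have det_h : ae G (fun x => \det (h x) = 1).
  by apply: (ae_mono maxG _ aeSL) => x; exact: SL3_inv.
have lim_w : lim_vec G (fun x => wedge (subst_form (h x) u) (subst_form (h x) v)) y.
  by under eq_fun do rewrite -[wedge _ _]ext2_act_wedge.
have [h0 limh] := bounded_mx_lim (proper maxG det_h (ex_intro _ y lim_w)).
have [det_h0 _] := lim_invmx maxG det_h limh.
exists (invmx h0); first exact: SL3_inv.
rewrite ext2_act_wedge !act_invmx.
have lim_uv f : lim_vec G (fun x => subst_form (h x) f) (subst_form h0 f).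
  by apply: (lim_subst maxG) limh; exact: (lim_vec_const maxG).
apply/ffunP => ij; apply: (lim_uniq maxG _ (lim_scalar maxG (ext2_entry_scalar ij) lim_w)).
rewrite ffunE; under eq_fun do rewrite ffunE.
by apply: (limB maxG); apply: (limM maxG); exact: lim_uv.
Qed.

(** An entry with infinitely many values satisfies no polynomial equation, so its
    inverse may be sent to 0. *)
Lemma stabilizer_finite : finite_set (SL3_stabilizer (ext2_act act) w).
Proof.
set S := SL3_stabilizer _ _; apply: contrapT => infS.
have [i [j inf_ij]] : exists i j, ~ finite_set [set x i j | x in S].
  apply: contrapT => h; apply: infS; apply: finite_matrices => i j.
  by apply: contrapT => n; apply: h; exists i, j.
pose G0 : set ((matrix_space C -> C) * C) := fun z => exists p : {poly C},
  (forall x : 'M[C]_3, S x -> x i j != 0 -> z.1 x = p.[(x i j)^-1]) /\ z.2 = p.[0].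
have hG0 : limit_graph G0.
  split.
  - by move=> c; exists c%:P; split => [x _ _|]; rewrite hornerC.
  - move=> z1 z2 [p [p1 p2]] [q [q1 q2]]; exists (p + q).
    by split => [x Sx x0|]; rewrite hornerD -?p2 -?q2 -?p1 -?q1.
  - move=> z1 z2 [p [p1 p2]] [q [q1 q2]]; exists (p * q).
    by split => [x Sx x0|]; rewrite hornerM -?p2 -?q2 -?p1 -?q1.
  - move=> [p [/= p1 p2]]; apply: inf_ij.
    have p0 : p != 0 by apply: contra_eq_neq p2 => ->; rewrite horner0 oner_eq0.
    apply: (sub_finite_set (B := [set 0] `|` [set t^-1 | t in [set t | p.[t] = 0]])).
      move=> _ [x Sx <-]; have [->|x0] := eqVneq (x i j) 0; first by left.
      by right; exists (x i j)^-1; rewrite ?invrK //= -p1.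
    by rewrite finite_setU; split; [exact: finite_set1|apply/finite_image/finite_poly_zeros].
have [G maxG G0G] := maximal_graph_exists hG0.
have aeS : ae G (fun x => S x /\ (x : 'M[C]_3) i j != 0).
  by apply: G0G; exists 1; split => [x Sx x0|]; rewrite hornerC //= asboolT.
have pole : lim G (fun x => ((x : 'M[C]_3) i j)^-1) 0.
  by apply: G0G; exists 'X; split => [x Sx x0|]; rewrite hornerX.
pose h (x : matrix_space C) := invmx (x : 'M[C]_3).
have det_h : ae G (fun x => \det (h x) = 1).
  by apply: (ae_mono maxG _ aeS) => x [[sx _] _]; exact: SL3_inv.
have lim_w : lim_vec G (fun x => wedge (subst_form (h x) u) (subst_form (h x) v)) w.
  apply: (lim_vec_ae maxG aeS _ (lim_vec_const maxG w)) => x [[_ xw] _].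
  by rewrite -[RHS]ext2_act_wedge.
have [h0 limh] := bounded_mx_lim (proper maxG det_h (ex_intro _ w lim_w)).
have [_ /(_ i j)] := lim_invmx maxG det_h limh.
rewrite /h; under eq_fun do rewrite invmxK.
move=> /(limM maxG pole); rewrite mul0r => lim0.
suff /(lim_uniq maxG lim0)/eqP : lim G (fun x => ((x : 'M[C]_3) i j)^-1 * (x : 'M[C]_3) i j) 1.
  by rewrite eq_sym oner_eq0.
by apply: (lim_ae maxG aeS _ (lim_const maxG 1)) => x [_ x0]; rewrite mulVf.
Qed.

End PencilStable.

Theorem pencil_stable (C : numClosedFieldType) (d : nat)
    (P : {vspace ternary_form C d}) (hP : pencil P)
    (hmem : forall D : {vspace ternary_form C d}, curve_in P D ->
       stable_curve D \/ strictly_semistable_curve D)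
    (hone : forall D D' : {vspace ternary_form C d}, curve_in P D -> curve_in P D' ->
       strictly_semistable_curve D -> strictly_semistable_curve D' -> D = D') :
  stable_pencil P.
Proof.
rewrite /stable_pencil /plucker.
set u := (vbasis P)`_0; set v := (vbasis P)`_1.
have sz : size (vbasis P) = 2 by rewrite size_tuple.
have eX : vbasis P = [:: u; v] :> seq _.
  by rewrite /u /v; case: (tval _) sz => [|? [|? []]].
have free_uv : free [:: u; v] by rewrite -eX; exact: basis_free (vbasisP P).
have uP : u \in P by apply: vbasis_mem; apply: mem_nth; rewrite sz.
have vP : v \in P by apply: vbasis_mem; apply: mem_nth; rewrite sz.
have indep b c : b *: u + c *: v = 0 -> b = 0 /\ c = 0.
  move: free_uv; rewrite free_cons seq1_free span_seq1 => /andP[uv v0].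
  have [->|b0] := eqVneq b 0.
    by rewrite scale0r add0r => /eqP; rewrite scaler_eq0 (negPf v0) orbF => /eqP.
  move=> /eqP; rewrite addr_eq0 => /eqP bu; case/negP: uv.
  rewrite -[u]scale1r -(mulVf b0) -scalerA bu; apply: rpredZ.
  by rewrite -scaleNr; apply: rpredZ; exact: memv_line.
have curve f : f \in P -> f != 0 -> curve_in P <[f]>.
  by move=> fP f0; split; [rewrite dim_vline f0|rewrite -memvE].
have [u0 v0] : u != 0 /\ v != 0.
  split; apply/eqP => z0.
    by have [] := @indep 1 0; [rewrite z0 scaler0 scale0r addr0|move/eqP; rewrite oner_eq0].
  by have [] := @indep 0 1; [rewrite z0 scaler0 scale0r addr0|move=> _ /eqP; rewrite oner_eq0].
have proper : proper_orbit_map u v.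
  move=> G h maxG; apply: (pencil_proper indep) => //.
    by move=> b c f -> f0; apply: hmem; apply: curve => //; rewrite rpredD // rpredZ.
  by move=> ssu ssv; apply: hone => //; exact: curve.
exists (wedge u v); first split => //.
  apply/eqP => /wedge_eq0 h; have [|c vc] := h; first exact/eqP.
  have [] := @indep c (-1); first by rewrite scaleN1r vc subrr.
  by move=> _ /eqP; rewrite oppr_eq0 oner_eq0.
by split; [exact: orbit_closed|exact: stabilizer_finite].
Qed.

Theorem theorem1p5 (R : realType) (d : nat) (hd : (1 <= d)%N)
    (P : {vspace ternary_form R[i] d}) (hP : pencil P)
    (hmem : forall C : {vspace ternary_form R[i] d}, curve_in P C ->
       stable_curve C \/ strictly_semistable_curve C)
    (hone : forall C C' : {vspace ternary_form R[i] d}, curve_in P C -> curve_in P C' ->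
       strictly_semistable_curve C -> strictly_semistable_curve C' -> C = C') :
  stable_pencil P.
Proof. exact: (@pencil_stable R[i] d P). Qed.
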